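(* Let $F_{\Psi}:\mathcal{R}\to\mathcal{R}$ be the $\Psi$-lift of an expanding interval map $F$. For every $\alpha\in\mathbb{R}$ the $\alpha$-escaping set $\mathbf{E}(\alpha)$ and the uniformly $\alpha$-escaping set $\mathbf{E}_u(\alpha)$ satisfy $$\dim_H(\mathbf{E}(\alpha))=\dim_H(\mathbf{E}_u(\alpha))=\delta_\alpha .$$
   Context: Setting. Let $I=\{1,\dots,m\}$, $m\ge 2$, and let $I_i\subset[0,1]$, $i\in I$, be pairwise disjoint intervals with non-empty interior. $F$ is an expanding interval map with $C^{1+\epsilon}$ full branches $F|_{I_i}:I_i\to[0,1]$: the continuous continuation $H_i$ of $F|_{I_i}$ to $\overline{I_i}$ is a $C^{1+\epsilon}$ diffeomorphism of $\overline{I_i}$ onto $[0,1]$ with $|H_i'|>1$. Put $h_i=H_i^{-1}:[0,1]\to\overline{I_i}$. Let $\Sigma=I^{\mathbb{N}}$ with left shift $\sigma$ and metric $d(\omega,\tau)=\exp(-\max\{k\ge0:\omega_1=\tau_1,\dots,\omega_k=\tau_k\})$, and let $\pi:\Sigma\to[0,1]$ be the coding map, $\{\pi(\omega)\}=\bigcap_{n}h_{\omega_1}\circ\cdots\circ h_{\omega_n}([0,1])$. Let $I^\star$ be the set of all finite words over $I$ (including the empty word), $|\omega|$ the length of $\omega\in I^\star$, and $[\omega]=\{x\in\Sigma: x|_{|\omega|}=\omega\}$ the cylinder of $\omega$. Let $\mathcal{D}=\bigcup_{(\omega_1,\dots,\omega_n)\in I^\star}h_{\omega_1}\circ\cdots\circ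 h_{\omega_n}(\{0,1\})$ (the empty word contributing $\{0,1\}$) and $\mathcal{R}=(\pi(\Sigma)\setminus\mathcal{D})+\mathbb{Z}\subset\mathbb{R}$. Let $\Psi:[0,1]\to\mathbb{Z}$ be constant on each $I_i$. The $\Psi$-lift of $F$ is $F_\Psi:\mathcal{R}\to\mathcal{R}$, $F_\Psi(x)=\sum_{k\in\mathbb{Z}}\big(k+F(x-k)+\Psi(x-k)\big)\mathbf{1}_{[0,1]}(x-k)$. For $f:\Sigma\to\mathbb{R}$ put $S_nf=\sum_{k=0}^{n-1}f\circ\sigma^k$ and, for $\omega\in I^\star$, $S_\omega f=\sup_{x\in[\omega]}S_{|\omega|}f(x)$. The geometric potential $\varphi:\Sigma\to(-\infty,0)$ is the Hölder continuous function with $\varphi(\omega)=-\log|F'(\pi(\omega))|$ except possibly on a finite set (i.e. $\varphi(\omega)=-\log|H_{\omega_1}'(\pi(\omega))|$). The symbolic step length function $\psi:\Sigma\to\mathbb{Z}$ is constant on one-cylinder sets and equals $\Psi\circ\pi$ except possibly on a finite set (i.e. $\psi(\omega)$ is the value of $\Psi$ on $I_{\omega_1}$). For $\alpha\in\mathbb{R}$ the $\alpha$-Poincaré exponent is $$\delta_\alpha=\inf\Big\{s\ge0:\ \sum_{\omega\in I^\star,\ |S_\omega(\psi-\alpha)|\le K}e^{s\,S_\omega\varphi}<\infty\Big\},$$ where $K>0$ is sufficiently large. The $\alpha$-escaping set is $\mathbf{E}(\alpha)=\{x\in\mathcal{R}:\exists K>0\ |F_\Psi^n(x)-n\alpha|\le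 K\text{ for infinitely many }n\in\mathbb{N}\}$ and the uniformly $\alpha$-escaping set is $\mathbf{E}_u(\alpha)=\{x\in\mathcal{R}:\exists K>0\ \forall n\in\mathbb{N}\ |F_\Psi^n(x)-n\alpha|\le K\}$. $\dim_H$ is Hausdorff dimension, with $\dim_H\emptyset=0$. *)

(* Defs.v *)
From HB Require Import structures.
From mathcomp Require Import all_boot all_order all_algebra.
From mathcomp Require Import all_classical all_reals all_analysis.

Set Implicit Arguments.
Unset Strict Implicit.
Unset Printing Implicit Defensive.

Import Order.TTheory GRing.Theory Num.Theory.
Import numFieldNormedType.Exports.

Local Open Scope classical_set_scope.
Local Open Scope ring_scope.

Section Hausdorff.
Context {R : realType}.

Definition diam (A : set R) : \bar R :=
  ereal_sup [set (`|p.1 - p.2|)%:E | p in A `*` A].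

(* The empty set has weight 0 for every s, while at s = 0 a singleton has
   weight 0 `^ 0 = 1, so that the 0-dimensional measure is counting measure. *)
Definition diam_weight (s : R) (A : set R) : \bar R :=
  if `[< A = set0 >] then 0%E else (diam A `^ s)%E.

Definition hausdorff_premeasure (s d : R) (E : set R) : \bar R :=
  ereal_inf [set (\sum_(0 <= n <oo) diam_weight s (U n))%E |
    U in [set U : (set R)^nat |
           E `<=` \bigcup_n U n /\ forall n, (diam (U n) <= d%:E)%E]].

(* The premeasure is nonincreasing in d, so this supremum is its limit as d
   tends to 0 from above. *)
Definition hausdorff_measure (s : R) (E : set R) : \bar R :=
  ereal_sup [set hausdorff_premeasure s d E | d in [set d : R | 0 < d]].

Definition hausdorff_dim (E : set R) : \bar R :=
  ereal_inf [set s%:E | s in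
    [set s : R | 0 <= s /\ hausdorff_measure s E = 0%E]].

End Hausdorff.

Section Smoothness.
Context {R : realType}.

(* Difference quotients along A only: one-sided at the endpoints of an
   interval. *)
Definition diff_quotient (A : set R) (f : R -> R) (x : R) : set_system R :=
  (fun y => (f y - f x) / (y - x)) @ within A x^'.

Definition derivable_on (A : set R) (f : R -> R) (x : R) : Prop :=
  cvg (diff_quotient A f x).

Definition deriv_on (A : set R) (f : R -> R) (x : R) : R :=
  lim (diff_quotient A f x).

Definition C1_hoelder (eps : R) (A : set R) (f : R -> R) : Prop :=
  (forall x, A x -> derivable_on A f x) /\
  exists C : R, forall x y, A x -> A y ->
    `|deriv_on A f x - deriv_on A f y| <= C * `|x - y| `^ eps.

Definition C1_hoelder_diffeo (eps : R) (A B : set R) (f : R -> R) : Prop :=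
  [/\ set_bij A B f, C1_hoelder eps A f & C1_hoelder eps B (pinv A f)].

End Smoothness.

(* [eim_branch i] is relevant only on the closure of [eim_dom i], and
   [eim_fun] only on the union of the [eim_dom i]. *)
Record expanding_interval_map (R : realType) (m : nat) := ExpandingIntervalMap {
  eim_dom : 'I_m -> set R;
  eim_fun :> R -> R;
  eim_branch : 'I_m -> R -> R;
  eim_eps : R;
  eim_dom_itv : forall i, is_interval (eim_dom i);
  eim_dom_sub : forall i, eim_dom i `<=` `[0, 1];
  eim_dom_interior : forall i, (eim_dom i)° !=set0;
  eim_dom_disjoint : forall i j, i != j -> eim_dom i `&` eim_dom j = set0;
  eim_branchE : forall i x, eim_dom i x -> eim_branch i x = eim_fun x;
  eim_eps_gt0 : 0 < eim_eps;
  eim_eps_le1 : eim_eps <= 1;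
  eim_branch_cts : forall i,
    {within closure (eim_dom i), continuous (eim_branch i)};
  eim_branch_diffeo : forall i,
    C1_hoelder_diffeo eim_eps (closure (eim_dom i)) `[0, 1] (eim_branch i);
  eim_branch_expanding : forall i x, closure (eim_dom i) x ->
    1 < `|deriv_on (closure (eim_dom i)) (eim_branch i) x|
}.

Section Symbolic.
Context {R : realType} {m : nat}.

(* Sequences and words are indexed from 0: the first letter of w is w 0. *)
Definition shift (w : nat -> 'I_m) : nat -> 'I_m := fun n => w n.+1.

Definition prefix_word (w : nat -> 'I_m) (n : nat) : seq 'I_m := mkseq w n.

Definition cylinder (u : seq 'I_m) : set (nat -> 'I_m) :=
  [set w | prefix_word w (size u) = u].

Definition birkhoff_sum (f : (nat -> 'I_m) -> R) (n : nat) (w : nat -> 'I_m) : R :=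
  \sum_(k < n) f (iter k shift w).

Definition word_sum (f : (nat -> 'I_m) -> R) (u : seq 'I_m) : R :=
  sup [set birkhoff_sum f (size u) w | w in cylinder u].

End Symbolic.

Section Lift.
Context {R : realType} {m : nat} (F : expanding_interval_map R m).

Definition inv_branch (i : 'I_m) : R -> R :=
  pinv (closure (eim_dom F i)) (eim_branch F i).

Definition inv_branch_word (u : seq 'I_m) : R -> R :=
  foldr (fun i g => inv_branch i \o g) id u.

Definition coding (w : nat -> 'I_m) : R :=
  get (\bigcap_n (inv_branch_word (prefix_word w n) @` `[0, 1])).

Definition endpoints : set R :=
  \bigcup_(u in [set: seq 'I_m]) (inv_branch_word u @` [set 0; 1]).

Definition lift_space : set R :=
  [set x + k%:~R | x in range coding `\` endpoints & k in [set: int]].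

Definition geometric_potential (w : nat -> 'I_m) : R :=
  - ln `|deriv_on (closure (eim_dom F (w 0%N))) (eim_branch F (w 0%N)) (coding w)|.

Variable Psi : R -> int.

Definition constant_on_branches : Prop :=
  forall i x y, eim_dom F i x -> eim_dom F i y -> Psi x = Psi y.

Definition step_length (w : nat -> 'I_m) : int :=
  xget 0 (Psi @` eim_dom F (w 0%N)).

(* Finitely supported sum over the integers: at most two translates of x lie
   in [0, 1]. *)
Definition lift (x : R) : R :=
  \sum_(k \in [set: int])
    ((k%:~R + F (x - k%:~R) + (Psi (x - k%:~R))%:~R) * \1_`[0, 1] (x - k%:~R)).

Definition escaping (alpha : R) : set R :=
  [set x | lift_space x /\ exists2 K : R, 0 < K &
    infinite_set [set n : nat | `|iter n lift x - n%:R * alpha| <= K]].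

Definition uniformly_escaping (alpha : R) : set R :=
  [set x | lift_space x /\ exists2 K : R, 0 < K &
    forall n : nat, `|iter n lift x - n%:R * alpha| <= K].

Definition bounded_words (alpha K : R) : set (seq 'I_m) :=
  [set u | `|word_sum (fun w => (step_length w)%:~R - alpha) u| <= K].

Definition poincare_exponent (alpha K : R) : \bar R :=
  ereal_inf [set s%:E | s in [set s : R | 0 <= s /\
    (\esum_(u in bounded_words alpha K)
       (expR (s * word_sum geometric_potential u))%:E < +oo)%E]].

End Lift.

(* Main.v *)
Require Import Defs.
From mathcomp Require Import all_boot all_order all_algebra.
From mathcomp Require Import all_classical all_reals all_analysis.
From mathcomp Require Import ring lra.

(* Write [h_u] for the composed inverse branch of a word [u] and [l u] for the
   length of the cylinder [h_u [0, 1]]. Bounded distortion makes [l] almost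
   multiplicative and comparable to [exp (S_u phi)], so the Poincare exponent
   can be computed from the series of the [l u ^ s] over the words whose letter
   sum (of [psi - alpha]) is bounded by [K].

   Upper bound: a point of the escaping set is, up to an integer translation, in
   infinitely many cylinders of words with letter sum at most some [N], and
   finiteness of the series for one large [K] implies it for all [N]: words can
   be steered back into [[-K, K]] by appended letters if [psi - alpha] takes
   both signs, and otherwise contain boundedly many letters with
   [psi - alpha != 0].

   Lower bound: if the series diverges at [s > t], one word length carries
   arbitrarily large mass [sum (l u) ^ t]; blocks of that length, separated by
   correcting words that keep the running letter sum bounded, form a tree in
   which the children of [v] have total mass at least [3 (l v) ^ t]. No measure
   is built on its limit set. Given sets [B_j] with [diam (B_j) ^ t <= a_j] and
   small total mass, one descends the tree keeping the mass of the [B_j] that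
   meet the current cylinder below [c (l v) ^ t]: such a [B_j] is shorter than
   each child, hence meets at most two of them, so some child inherits the
   bound. The limit point lies in no [B_j], since [a_j > 0]. *)

Set Implicit Arguments.
Unset Strict Implicit.
Unset Printing Implicit Defensive.

Import Order.TTheory GRing.Theory Num.Theory.
Import numFieldNormedType.Exports.

Local Open Scope classical_set_scope.
Local Open Scope ring_scope.

(** * Branches *)

Section Branches.
Context {R : realType} {m : nat} (F : expanding_interval_map R m).

Local Notation C i := (closure (eim_dom F i)).
Local Notation H i := (eim_branch F i).
Local Notation D i x := (`|deriv_on (C i) (H i) x|).

Lemma compact_interval_segment (A : set R) : compact A -> is_interval A ->
  A !=set0 -> exists a b, A = `[a, b]%classic.
Proof.
move=> cA iA A0.
have cid : {within A, continuous (@id R)}.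
  by apply: continuous_subspaceT => x; exact: cvg_id.
have [a /set_mem Aa amin] := compact_EVT_min A0 cA cid.
have [b /set_mem Ab bmax] := compact_EVT_max A0 cA cid.
exists a, b; apply/seteqP; split=> x /=; rewrite in_itv/=.
  by move=> Ax; rewrite amin ?bmax ?inE.
by move=> xab; exact: (iA _ _ Aa Ab).
Qed.

(** The closure is compact and connected, hence a segment; a ball inside the domain keeps its two
    ends apart. *)
Lemma closure_dom_segment i :
  exists a b, [/\ 0 <= a, a < b, b <= 1 & C i = `[a, b]%classic].
Proof.
have Csub : C i `<=` `[0, 1].
  rewrite [X in _ `<=` X](closure_id _).1; last exact: itv_closed.
  exact/closure_subset/eim_dom_sub.
have [x xint] := eim_dom_interior F i.
have [a [b Cab]] : exists a b, C i = `[a, b]%classic.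
  apply: compact_interval_segment.
  - apply: (subclosed_compact (@closed_closure _ _)) Csub; exact: segment_compact.
  - apply/connected_intervalP/connected_closure/connected_intervalP.
    exact: eim_dom_itv.
  - exists x; apply: subset_closure; exact: interior_subset xint.
exists a, b.
have ab : a < b.
  move: xint; rewrite /interior/= => /nbhs_ballP[e /= e0 xe].
  have h (y : R) : `|x - y| < e -> a <= y <= b.
    move=> xy; have : C i y by apply: subset_closure; exact: xe.
    by rewrite Cab /= in_itv.
  have /h/andP[h1 h2] : `|x - (x + e / 2)| < e.
    by rewrite opprD addrA subrr sub0r normrN gtr0_norm ?divr_gt0//; lra.
  have /h/andP[h3 h4] : `|x - x| < e by rewrite subrr normr0.
  by apply: (le_lt_trans h3); apply: lt_le_trans h2; rewrite ltrDl divr_gt0.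
have : `[a, b]%classic `<=` `[0, 1]%classic by rewrite -Cab.
have aab : a \in `[a, b] by rewrite in_itv/= lexx ltW.
have bab : b \in `[a, b] by rewrite in_itv/= lexx ltW.
move=> h; have := h _ aab; have := h _ bab.
by rewrite /= !in_itv/= => /andP[_ b1] /andP[a0 _]; split.
Qed.

Lemma closure_dom_itv i x y z : C i x -> C i z -> x <= y <= z -> C i y.
Proof.
have [a [b [_ _ _ ->]]] := closure_dom_segment i.
rewrite /= !in_itv/= => /andP[ax _] /andP[_ zb] /andP[xy yz].
by rewrite (le_trans ax xy) (le_trans yz zb).
Qed.

(* [closure] unfolds to a product whose arguments would be made implicit. *)
Arguments closure_dom_itv {i x y z} _ _ _ B _.

(** [deriv_on] is a limit along the closed domain only. At an interior point the domain is a
    neighbourhood, so this limit is the ordinary derivative and the mean value theorem applies. *)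
Lemma branch_derive i (a b x : R) : C i = `[a, b]%classic -> x \in `]a, b[ ->
  is_derive x 1 (H i) (deriv_on (C i) (H i) x).
Proof.
move=> Cab xab; have Cx : C i x.
  by rewrite Cab/=; exact: subset_itv_oo_cc xab.
have [_ [/(_ _ Cx) dH _] _] := eim_branch_diffeo F i.
have Cn : nbhs x (C i).
  rewrite Cab; apply: (@filterS _ _ _ `]a, b[%classic).
    exact: subset_itv_oo_cc.
  by move: xab; rewrite in_itv/=; exact: near_in_itvoo.
have lim_h : h^-1 *: ((H i \o shift x) (h *: 1) - H i x) @[h --> 0^']
    --> deriv_on (C i) (H i) x.
  apply/cvgrPdist_lt => e e0.
  have : nbhs x (fun y => y != x -> C i y ->
      `|deriv_on (C i) (H i) x - (H i y - H i x) / (y - x)| < e).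
    by have /cvgrPdist_lt/(_ e e0) := dH.
  move=> /nbhs_ballP[d /= d0 hd].
  have [d' /= d'0 hd'] := (nbhs_ballP _ _).1 Cn.
  apply/nbhs_ballP; exists (Num.min d d') => /=; first by rewrite lt_min d0.
  move=> h /=; rewrite /ball/= sub0r normrN lt_min => /andP[hd1 hd2] h0.
  rewrite /shift/= scaler1.
  have xh : `|x - (h + x)| = `|h| by rewrite -normrN opprB addrK.
  have := hd (h + x); rewrite /ball/= xh => /(_ hd1).
  rewrite addrK mulrC; apply.
    by rewrite -subr_eq0 addrK.
  by apply: hd'; rewrite /ball/= xh.
apply: DeriveDef; first by apply/cvg_ex; exists (deriv_on (C i) (H i) x).
by apply/cvg_lim.
Qed.

(** The location of [z] between [x] and [y] is recorded for the distortion estimate. *)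
Lemma branch_MVT i x y : C i x -> C i y -> exists z,
  [/\ C i z, Num.min x y <= z <= Num.max x y &
      `|H i x - H i y| = D i z * `|x - y|].
Proof.
wlog xy : x y / x <= y => [hw Cx Cy|].
  case/orP: (le_total x y) => [xy|yx]; first exact: hw.
  have [z []] := hw _ _ yx Cy Cx.
  by rewrite minC maxC (distrC (H i y)) (distrC y); exists z.
move=> Cx Cy; move: xy; rewrite le_eqVlt => /orP[/eqP ->|xy].
  by exists y; rewrite minxx maxxx lexx !subrr normr0 mulr0.
have [a [b [_ _ _ Cab]]] := closure_dom_segment i.
have /andP[ay yb] : a <= y <= b by move: Cy; rewrite Cab/= in_itv.
have /andP[ax xb] : a <= x <= b by move: Cx; rewrite Cab/= in_itv.
have sub z : z \in `]x, y[ -> z \in `]a, b[.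
  by rewrite !in_itv/= => /andP[xz zy]; rewrite (le_lt_trans ax)// (lt_le_trans zy).
have cH : {within `[x, y], continuous H i}.
  apply: continuous_subspaceW (@eim_branch_cts _ _ F i) => z /=.
  by rewrite in_itv/=; exact: closure_dom_itv Cx Cy.
have [z zxy Hz] := MVT xy (fun z zxy => branch_derive Cab (sub z zxy)) cH.
exists z; move: (zxy); rewrite in_itv/= => /andP[/ltW xz /ltW zy].
split; first by apply: closure_dom_itv Cx Cy _; rewrite xz zy.
  by rewrite min_l ?max_r ?(ltW xy)// xz zy.
by rewrite distrC Hz normrM (distrC x) (gtr0_norm (_ : 0 < y - x)) ?subr_gt0.
Qed.

Lemma hoelder_continuous (A : set R) (f : R -> R) (K e : R) : 0 < e ->
  (forall x y, A x -> A y -> `|f x - f y| <= K * `|x - y| `^ e) ->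
  {within A, continuous f}.
Proof.
move=> e0 hf; apply/subspace_continuousP => x Ax; apply/cvgrPdist_lt => d d0.
(* [K] may be zero or negative, so the radius is built from a positive majorant. *)
pose K1 := `|K| + 1.
have K10 : 0 < K1 by rewrite ltr_wpDl.
apply/nbhs_ballP; exists ((d / K1) `^ e^-1) => /=.
  by apply: powR_gt0; exact: divr_gt0.
move=> y /= xy Ay; apply: (le_lt_trans (hf _ _ Ax Ay)).
have : `|x - y| `^ e < d / K1.
  have dK : 0 <= d / K1 by rewrite divr_ge0// ltW.
  have -> : d / K1 = ((d / K1) `^ e^-1) `^ e.
    by rewrite -powRrM mulVf ?powRr1// gt_eqF.
  by rewrite gt0_ltr_powR// nnegrE ?powR_ge0//.
rewrite ltr_pdivlMr// mulrC; apply: le_lt_trans.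
by rewrite ler_wpM2r ?powR_ge0// (le_trans (ler_norm _))// lerDl.
Qed.

(** By Hoelder continuity [D i] attains its minimum on each of the finitely many closed domains. The
    2 is a start value above 1 for the minimum over the branches. *)
Lemma branch_expansion : exists2 l : R, 1 < l &
  forall i x, C i x -> l <= D i x.
Proof.
have /choice[l hl] : forall i, exists l : R,
    1 < l /\ forall x, C i x -> l <= D i x.
  move=> i; have [a [b [_ ab _ Cab]]] := closure_dom_segment i.
  have [_ [_ [K hK]] _] := eim_branch_diffeo F i.
  have cD : {within `[a, b], continuous (fun x => D i x)}.
    rewrite -Cab; apply: (hoelder_continuous (eim_eps_gt0 F)) => x y Cx Cy.
    by apply: le_trans (hK _ _ Cx Cy); exact: ler_dist_dist.
  have [c cab hc] := EVT_min (ltW ab) cD.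
  exists (D i c); split; first by apply: eim_branch_expanding; rewrite Cab.
  by move=> x Cx; apply: hc; move: Cx; rewrite {1}Cab.
exists (\big[Num.min/2]_i l i).
  by apply: lt_bigmin => [|i _]; [rewrite ltr1n|exact: (hl i).1].
move=> i x Cx; apply: (le_trans _ ((hl i).2 _ Cx)); exact: bigmin_le_cond.
Qed.

Lemma ln_lipschitz (a b : R) : 1 <= a -> 1 <= b -> `|ln a - ln b| <= `|a - b|.
Proof.
wlog ba : a b / b <= a => [hw a1 b1|a1 b1].
  case/orP: (le_total a b) => ab; last exact: hw.
  by rewrite distrC (distrC a); exact: hw.
have b0 : 0 < b by apply: lt_le_trans b1.
have a0 : 0 < a by apply: lt_le_trans a1.
rewrite !ger0_norm ?subr_ge0 ?ler_ln ?posrE//.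
rewrite -ln_div ?posrE//.
have -> : a / b = 1 + (a - b) / b by rewrite mulrBl divff ?gt_eqF//; ring.
apply: le_trans (le_ln1Dx _) _; last by rewrite ler_pdivrMr// ler_peMr ?subr_ge0.
by rewrite (lt_le_trans (ltrN10 _))// divr_ge0 ?subr_ge0// ltW.
Qed.

(** The derivatives exceed 1 in modulus, where [ln] is 1-Lipschitz, so the logarithm inherits the
    Hoelder bound. The sum of the constants serves all branches. *)
Lemma branch_distortion : exists2 K : R, 0 <= K & forall i x y, C i x -> C i y ->
  `|ln (D i x) - ln (D i y)| <= K * `|x - y| `^ eim_eps F.
Proof.
have /choice[K hK] : forall i, exists K : R, forall x y, C i x -> C i y ->
    `|deriv_on (C i) (H i) x - deriv_on (C i) (H i) y|
      <= K * `|x - y| `^ eim_eps F.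
  by move=> i; have [_ [_ [K hK]] _] := eim_branch_diffeo F i; exists K.
exists (\sum_i `|K i|); first by rewrite sumr_ge0.
move=> i x y Cx Cy.
apply: (le_trans (ln_lipschitz _ _)); try exact/ltW/eim_branch_expanding.
apply: (le_trans (ler_dist_dist _ _)); apply: (le_trans (hK _ _ _ Cx Cy)).
rewrite ler_wpM2r ?powR_ge0// (bigD1 i)//= (le_trans (ler_norm _))// lerDl.
by rewrite sumr_ge0.
Qed.

Local Notation h i := (inv_branch F i).

Lemma inv_branchP i p : 0 <= p <= 1 -> C i (h i p) /\ H i (h i p) = p.
Proof.
move=> p01; have [Hbij _ _] := eim_branch_diffeo F i.
have p01' : p \in `[0, 1]%classic by rewrite inE/= in_itv.
split; last exact: (surjpK _ (set_bij_surj Hbij)).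
by have /set_bij_homo := bijpinv_bij (fun=> point) Hbij; apply; rewrite /= in_itv.
Qed.

Lemma inv_branch_itv i p : 0 <= p <= 1 -> 0 <= h i p <= 1.
Proof.
move=> /(inv_branchP i)[+ _].
have [a [b [a0 _ b1 ->]]] := closure_dom_segment i.
by rewrite /= in_itv/= => /andP[/(le_trans a0)-> /le_trans->].
Qed.

Lemma inv_branch_MVT i p q : 0 <= p <= 1 -> 0 <= q <= 1 -> exists z,
  [/\ C i z, Num.min (h i p) (h i q) <= z <= Num.max (h i p) (h i q) &
      `|p - q| = D i z * `|h i p - h i q|].
Proof.
move=> /(inv_branchP i)[Cp Hp] /(inv_branchP i)[Cq Hq].
by have := branch_MVT Cp Cq; rewrite Hp Hq.
Qed.

Lemma inv_branch_contracts i p q : 0 <= p <= 1 -> 0 <= q <= 1 ->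
  `|h i p - h i q| <= `|p - q|.
Proof.
move=> p01 q01; have [z [Cz _ ->]] := inv_branch_MVT i p01 q01.
by rewrite ler_peMl// ltW// eim_branch_expanding.
Qed.

Lemma inv_branch_inj i p q : 0 <= p <= 1 -> 0 <= q <= 1 ->
  h i p = h i q -> p = q.
Proof.
by move=> /(inv_branchP i)[_ Hp] /(inv_branchP i)[_ Hq] e; rewrite -Hp -Hq e.
Qed.

(** A continuous injection of a segment is monotone; the images of 0 and 1 decide the direction. *)
Lemma inv_branch_monotone i :
  (forall p q, 0 <= p -> p <= q -> q <= 1 -> h i p <= h i q) \/
  (forall p q, 0 <= p -> p <= q -> q <= 1 -> h i q <= h i p).
Proof.
have hc : {within `[0, 1], continuous (inv_branch F i)}.
  apply: (@hoelder_continuous _ _ 1 1) => // p q; rewrite /= !in_itv/= => p01 q01.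
  by rewrite mul1r powRr1//; exact: inv_branch_contracts.
have hi : {in `[0, 1] &, injective (inv_branch F i)}.
  by move=> p q /=; rewrite !in_itv/=; exact: inv_branch_inj.
case/orP: (le_total (h i 0) (h i 1)) => h01; [left|right] => p q p0 pq q1.
  rewrite (segment_continuous_inj_le h01 hc hi) ?in_itv/= ?p0 ?q1 ?andbT//.
    exact: le_trans pq q1.
  exact: le_trans p0 pq.
rewrite (segment_continuous_inj_ge h01 hc hi) ?in_itv/= ?p0 ?q1 ?andbT//.
  exact: le_trans p0 pq.
exact: le_trans pq q1.
Qed.

Lemma closure_near (A : set R) (x e : R) : closure A x -> 0 < e ->
  exists2 y : R, A y & x - e < y < x + e.
Proof.
move=> cx e0; have [y [Ay]] := cx _ (nbhsx_ballx x e e0).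
by rewrite /ball/= distrC ltr_distl; exists y.
Qed.

(** A violation of the order in the closures can be moved to points of the domains themselves, where
    convexity yields a common point of disjoint intervals. Closures may share an end, hence the weak
    inequalities. *)
Lemma closure_dom_ordered i j : i != j ->
  (forall x y, C i x -> C j y -> x <= y) \/
  (forall x y, C i x -> C j y -> y <= x).
Proof.
move=> ij.
have sep (k l : 'I_m) p q : k != l -> eim_dom F k p -> eim_dom F l q -> p < q ->
    forall (x y : R), C k x -> C l y -> x <= y.
  move=> kl kp lq pq x y Ckx Cly; rewrite leNgt; apply/negP => yx.
  have e0 : 0 < (x - y) / 2 by rewrite divr_gt0// subr_gt0.
  have [x' kx' /andP[xx' _]] := closure_near Ckx e0.
  have [y' ly' /andP[_ yy']] := closure_near Cly e0.
  have y'x' : y' < x' by lra.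
  have dis z : eim_dom F k z -> eim_dom F l z -> False.
    move=> kz lz; have : (eim_dom F k `&` eim_dom F l) z by [].
    by rewrite eim_dom_disjoint.
  have x'q : x' < q.
    rewrite ltNge; apply/negP => qx'; apply: (dis q) => //.
    by apply: (@eim_dom_itv _ _ F _ _ _ kp kx'); rewrite (ltW pq).
  apply: (dis x') => //; apply: (@eim_dom_itv _ _ F _ _ _ ly' lq).
  by rewrite (ltW y'x') ltW.
have [p /interior_subset ip] := eim_dom_interior F i.
have [q /interior_subset jq] := eim_dom_interior F j.
have [pq|qp|pq] := ltgtP p q.
- by left; exact: (sep _ _ _ _ ij ip jq pq).
- right => x y Cx Cy; apply: (sep _ _ _ _ _ jq ip qp) Cy Cx.
  by rewrite eq_sym.
- have : (eim_dom F i `&` eim_dom F j) p by split=> //; rewrite pq.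
  by rewrite eim_dom_disjoint.
Qed.

(** [F] agrees with a branch only on the domain, not on its closure. By injectivity [h i p] lies
    strictly between [h i 0] and [h i 1], so domain points exist on both sides of it. *)
Lemma inv_branch_dom i p : 0 < p < 1 -> eim_dom F i (h i p).
Proof.
move=> /andP[p0 p1]; have p01 : 0 <= p <= 1 by rewrite !ltW.
have le00 : 0 <= (0 : R) <= 1 by rewrite lexx ler01.
have le11 : 0 <= (1 : R) <= 1 by rewrite ler01 lexx.
have [C0 _] := inv_branchP i le00.
have [C1 _] := inv_branchP i le11.
have nh q : 0 <= q <= 1 -> p != q -> h i p != h i q.
  by move=> q01; apply: contra_neq; exact: inv_branch_inj.
have btw u v : C i u -> C i v -> u < h i p -> h i p < v -> eim_dom F i (h i p).
  move=> Cu Cv up pv.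
  have [|u' iu' /andP[_ uu']] := closure_near (e := h i p - u) Cu.
    by rewrite subr_gt0.
  have [|v' iv' /andP[vv' _]] := closure_near (e := v - h i p) Cv.
    by rewrite subr_gt0.
  apply: (@eim_dom_itv _ _ F _ _ _ iu' iv'); lra.
have n0 : h i p != h i 0 by apply: nh; rewrite ?gt_eqF.
have n1 : h i p != h i 1 by apply: nh; rewrite ?lt_eqF.
have [mono|mono] := inv_branch_monotone i.
  apply: (btw _ _ C0 C1).
    by rewrite lt_neqAle eq_sym n0; apply: mono; rewrite ?lexx ?ltW.
  by rewrite lt_neqAle n1; apply: mono; rewrite ?lexx ?ltW.
apply: (btw _ _ C1 C0).
  by rewrite lt_neqAle eq_sym n1; apply: mono; rewrite ?lexx ?ltW.
by rewrite lt_neqAle n0; apply: mono; rewrite ?lexx ?ltW.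
Qed.

End Branches.

(** * Words and bounded distortion *)

Section Words.
Context {R : realType} {m : nat} (F : expanding_interval_map R m).

Local Notation C i := (closure (eim_dom F i)).
Local Notation D i x := (`|deriv_on (C i) (eim_branch F i) x|).
Local Notation h i := (inv_branch F i).
Local Notation hw u := (inv_branch_word F u).

Lemma inv_branch_word_cat u v p : hw (u ++ v) p = hw u (hw v p).
Proof. by elim: u => //= i u ->. Qed.

Lemma inv_branch_word_itv u p : 0 <= p <= 1 -> 0 <= hw u p <= 1.
Proof. by move=> p01; elim: u => //= i u; exact: inv_branch_itv. Qed.

Lemma inv_branch_word_inj u p q : 0 <= p <= 1 -> 0 <= q <= 1 ->
  hw u p = hw u q -> p = q.
Proof.
move=> p01 q01; elim: u => //= i u IH e; apply: IH.
by apply: (inv_branch_inj _ _ e); exact: inv_branch_word_itv.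
Qed.

Lemma inv_branch_word_monotone u :
  (forall p q, 0 <= p -> p <= q -> q <= 1 -> hw u p <= hw u q) \/
  (forall p q, 0 <= p -> p <= q -> q <= 1 -> hw u q <= hw u p).
Proof.
elim: u => [|i u IH] /=; first by left.
have b0 p q : 0 <= p -> p <= q -> q <= 1 -> [/\ 0 <= hw u p, 0 <= hw u q,
    hw u p <= 1 & hw u q <= 1].
  move=> p0 pq q1.
  have /andP[] : 0 <= hw u p <= 1.
    by apply: inv_branch_word_itv; rewrite p0 (le_trans pq).
  have /andP[] : 0 <= hw u q <= 1.
    by apply: inv_branch_word_itv; rewrite q1 (le_trans p0).
  by split.
by case: IH => mu; case: (inv_branch_monotone F i) => mi; [left|right|right|left];
  move=> p q p0 pq q1; have [*] := b0 _ _ p0 pq q1; apply: mi => //; exact: mu.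
Qed.

Lemma inv_branch_word_contracts : exists2 r : R, 0 < r < 1 & forall u p q,
  0 <= p <= 1 -> 0 <= q <= 1 -> `|hw u p - hw u q| <= r ^+ size u * `|p - q|.
Proof.
have [l l1 hl] := branch_expansion F.
have l0 : 0 < l by apply: lt_trans l1.
exists l^-1; first by rewrite invr_gt0 l0 invf_lt1.
move=> u p q p01 q01; elim: u => [|i u IH] /=; first by rewrite expr0 mul1r.
have [z [Cz _ e]] := inv_branch_MVT F i (inv_branch_word_itv u p01)
  (inv_branch_word_itv u q01).
rewrite exprS -mulrA ler_pdivlMl//; apply: le_trans IH; rewrite e.
by rewrite ler_wpM2r ?hl.
Qed.

Definition cyl_len u : R := `|hw u 1 - hw u 0|.

Lemma cyl_len_gt0 u : 0 < cyl_len u.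
Proof.
rewrite normr_gt0 subr_eq0; apply/eqP => /inv_branch_word_inj e.
by have := oner_neq0 R; rewrite e ?lexx ?ler01 ?eqxx.
Qed.

Lemma cyl_diam u p q : 0 <= p <= 1 -> 0 <= q <= 1 ->
  `|hw u p - hw u q| <= cyl_len u.
Proof.
move=> /andP[p0 p1] /andP[q0 q1]; rewrite /cyl_len.
case: (inv_branch_word_monotone u) => mu.
  have := mu _ _ p0 p1 (lexx _); have := mu _ _ q0 q1 (lexx _).
  have := mu _ _ (lexx _) p0 p1; have := mu _ _ (lexx _) q0 q1.
  by move=> ????; rewrite [leRHS]ger0_norm ?ler_norml; lra.
have := mu _ _ p0 p1 (lexx _); have := mu _ _ q0 q1 (lexx _).
have := mu _ _ (lexx _) p0 p1; have := mu _ _ (lexx _) q0 q1.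
by move=> ????; rewrite [leRHS]ler0_norm ?ler_norml; lra.
Qed.

Lemma cyl_len_exp : exists2 r : R, 0 < r < 1 &
  forall u, cyl_len u <= r ^+ size u.
Proof.
have [r r01 hr] := inv_branch_word_contracts; exists r => // u.
by have := hr u 1 0; rewrite lexx ler01 lexx subr0 normr1 mulr1; exact.
Qed.

(** The first differing letter decides; a common prefix preserves or reverses the order by
    monotonicity. *)
Lemma cylinders_ordered u v : size u = size v -> u != v ->
  (forall p q, 0 <= p <= 1 -> 0 <= q <= 1 -> hw u p <= hw v q) \/
  (forall p q, 0 <= p <= 1 -> 0 <= q <= 1 -> hw v q <= hw u p).
Proof.
elim: u v => [|i u IH] [|j v] //= [suv] uv.
have [eij|nij] := eqVneq i j; last first.
  by case: (closure_dom_ordered F nij) => o; [left|right] => p q p01 q01;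
    apply: o; apply: (inv_branchP F _ _).1; exact: inv_branch_word_itv.
rewrite eij in uv *; have {}uv : u != v by apply: contraNneq uv => ->.
case: (IH _ suv uv) => o; case: (inv_branch_monotone F j) => mj;
  [left|right|right|left] => p q p01 q01;
  have /andP[a0 a1] := inv_branch_word_itv u p01;
  have /andP[b0 b1] := inv_branch_word_itv v q01; apply: mj => //; exact: o.
Qed.

(** By the chain rule, the logarithm of the modulus of the derivative, at [hw u p], of the composed
    expanding branches that undo [hw u]. *)
Fixpoint log_deriv u p : R :=
  if u is i :: v then ln (D i (h i (hw v p))) + log_deriv v p else 0.

(** The reference point [z] is independent of [p] and [q]. For each letter the intermediate point of
    the mean value theorem is within [r ^+ n] of the orbit of [z], where [n] letters remain, so the
    logarithmic errors are summable. *)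
Lemma word_distortion : exists2 B : R, 0 <= B & forall u p q z,
  0 <= p <= 1 -> 0 <= q <= 1 -> 0 <= z <= 1 ->
  expR (- B - log_deriv u z) * `|p - q| <= `|hw u p - hw u q| /\
  `|hw u p - hw u q| <= expR (B - log_deriv u z) * `|p - q|.
Proof.
have [r /andP[r0 r1] hr] := inv_branch_word_contracts.
have [K K0 hK] := branch_distortion F.
pose e := eim_eps F; have e0 : 0 < e := eim_eps_gt0 F.
pose t := r `^ e.
have t0 : 0 <= t by rewrite powR_ge0.
have t1 : t < 1.
  have -> : 1 = 1 `^ e :> R by rewrite powR1.
  by rewrite gt0_ltr_powR ?nnegrE// ltW.
pose B := K / (1 - t).
have B0 : 0 <= B by rewrite divr_ge0// subr_ge0 ltW.
exists B => // u p q z p01 q01 z01.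
(* The k-th letter from the end contributes at most [K t ^ k] to the logarithmic
   distortion; [B (1 - t ^ n)] is the partial sum of that geometric series. *)
suff : expR (- (B * (1 - t ^+ size u)) - log_deriv u z) * `|p - q|
         <= `|hw u p - hw u q| /\
       `|hw u p - hw u q|
         <= expR (B * (1 - t ^+ size u) - log_deriv u z) * `|p - q|.
  have Bt : B * (1 - t ^+ size u) <= B.
    by rewrite ler_piMr// gerBl exprn_ge0.
  move=> [l1 l2]; split; [apply: le_trans l1|apply: (le_trans l2)];
    by rewrite ler_wpM2r// ler_expR; lra.
elim: u => [|i u IH] /=; first by rewrite expr0 subrr mulr0 !oppr0 !addr0 expR0 mul1r.
set n := size u in IH *.
have [x [Cx xab eab]] := inv_branch_MVT F i (inv_branch_word_itv u p01)
  (inv_branch_word_itv u q01).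
set c := hw u z.
have [Cc _] := inv_branchP F i (inv_branch_word_itv u z01).
have near_c y : 0 <= y <= 1 -> `|h i (hw u y) - h i c| <= r ^+ n.
  move=> y01; apply: le_trans (inv_branch_contracts _ _ _ _) _;
    do ?exact: inv_branch_word_itv.
  apply: (le_trans (hr _ _ _ y01 z01)); rewrite ler_piMr ?exprn_ge0 ?(ltW r0)//.
  by rewrite ler_norml; lra.
have xc : `|x - h i c| <= r ^+ n.
  have := near_c _ p01; have := near_c _ q01; rewrite !ler_norml.
  by move: xab; rewrite ge_min le_max => /andP[/orP[] ? /orP[] ?]; lra.
have hln : `|ln (D i x) - ln (D i (h i c))| <= K * t ^+ n.
  apply: (le_trans (hK _ _ _ Cx Cc)); rewrite ler_wpM2l// /t -powR_mulrn//.
  rewrite -powRrM mulrC powRrM powR_mulrn ?(ltW r0)//.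
  by rewrite ge0_ler_powR ?nnegrE ?exprn_ge0 ?(ltW r0) ?(ltW e0).
have KB : K * t ^+ n = B * (1 - t ^+ n.+1) - B * (1 - t ^+ n).
  rewrite exprS /B; field; lra.
have Dx0 : 0 < D i x by apply: lt_trans (eim_branch_expanding Cx).
have -> : `|h i (hw u p) - h i (hw u q)| = expR (- ln (D i x)) * `|hw u p - hw u q|.
  by rewrite eab expRN lnK ?posrE// mulKf// gt_eqF.
move: hln; rewrite KB ler_norml => /andP[k1 k2].
have [l1 l2] := IH; split.
  apply: le_trans (ler_wpM2l (expR_ge0 _) l1).
  by rewrite mulrA -expRD ler_wpM2r// ler_expR; lra.
apply: le_trans (ler_wpM2l (expR_ge0 _) l2) _.
by rewrite mulrA -expRD ler_wpM2r// ler_expR; lra.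
Qed.

Lemma cyl_len_log_deriv : exists2 A : R, 1 <= A & forall u z, 0 <= z <= 1 ->
  A^-1 * expR (- log_deriv u z) <= cyl_len u <= A * expR (- log_deriv u z).
Proof.
have [B B0 hB] := word_distortion; exists (expR B).
  by rewrite -[leLHS]expR0 ler_expR.
move=> u z z01; have [] := hB u 1 0 z; rewrite ?lexx ?ler01//.
by rewrite subr0 normr1 !mulr1 -expRN -!expRD => -> ->.
Qed.

(** Distortion of [u] is applied to the whole unit interval and to the cylinder of [v], with the
    same reference point 0; comparing the two costs the factor [expR (B + B)]. *)
Lemma cyl_len_cat : exists2 A : R, 1 <= A & forall u v,
  A^-1 * (cyl_len u * cyl_len v) <= cyl_len (u ++ v)
    <= A * (cyl_len u * cyl_len v).
Proof.
have [B B0 hB] := word_distortion.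
exists (expR (B + B)); first by rewrite -[leLHS]expR0 ler_expR addr_ge0.
move=> u v; rewrite {3 4}/cyl_len !inv_branch_word_cat.
have le01 : 0 <= (0 : R) <= 1 by rewrite lexx ler01.
have le11 : 0 <= (1 : R) <= 1 by rewrite ler01 lexx.
have [u1 u2] := hB u _ _ _ le11 le01 le01.
have [v1 v2] := hB u _ _ _ (inv_branch_word_itv v le11)
  (inv_branch_word_itv v le01) le01.
rewrite subr0 normr1 !mulr1 in u1 u2.
have lv : 0 <= cyl_len v := ltW (cyl_len_gt0 v).
apply/andP; split; [apply: le_trans v1|apply: (le_trans v2)].
  rewrite mulrA ler_wpM2r//; apply: (le_trans (ler_wpM2l _ u2)).
    by rewrite invr_ge0 expR_ge0.
  by rewrite -expRN -expRD ler_expR; lra.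
rewrite mulrA ler_wpM2r//; apply: le_trans (ler_wpM2l (expR_ge0 _) u1).
by rewrite -expRD ler_expR; lra.
Qed.

End Words.

(** * Coding *)

Section Coding.
Context {R : realType} {m : nat} (F : expanding_interval_map R m).
Implicit Types w : nat -> 'I_m.

Local Notation hw u := (inv_branch_word F u).
Local Notation shift := Defs.shift.

Lemma iter_shift w n k : iter n shift w k = w (n + k)%N.
Proof. by elim: n w k => //= n IH w k; rewrite /shift IH addnS. Qed.

Lemma size_prefix_word w n : size (prefix_word w n) = n.
Proof. exact: size_mkseq. Qed.

Lemma prefix_wordD w n k :
  prefix_word w (n + k) = prefix_word w n ++ prefix_word (iter n shift w) k.
Proof.
rewrite /prefix_word /mkseq iotaD map_cat add0n; congr (_ ++ _).
rewrite -{1}[n]addn0 iotaDl -map_comp; apply: eq_map => j /=.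
by rewrite iter_shift.
Qed.

Lemma exprn_small (r e : R) : 0 < r < 1 -> 0 < e -> exists n, r ^+ n < e.
Proof.
move=> /andP[r0 r1] e0; have : `|r| < 1 by rewrite gtr0_norm.
move=> /cvg_expr/cvgrPdist_lt/(_ e e0)[N _ /(_ N (leqnn N))].
by rewrite sub0r normrN ger0_norm ?exprn_ge0 ?ltW//; exists N.
Qed.

Lemma cylinder_image_closed (u : seq 'I_m) : closed (hw u @` `[0, 1]).
Proof.
apply: compact_closed; first exact: Rhausdorff.
apply: continuous_compact; last exact: segment_compact.
apply: (@hoelder_continuous _ _ _ 1 1) => // p q.
rewrite /= !in_itv/= => p01 q01; rewrite mul1r powRr1//.
have [r /andP[r0 r1] hr] := inv_branch_word_contracts F.
apply: (le_trans (hr _ _ _ p01 q01)); rewrite ler_piMl//.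
by rewrite exprn_ile1 ?ltW.
Qed.

(** [coding] is a choice by [get], meaningful once the intersection is inhabited. A cluster point of
    the images of 0 lies in every cylinder, since these are closed and nested. *)
Lemma coding_ex w :
  exists x, (\bigcap_n (hw (prefix_word w n) @` `[0, 1])) x.
Proof.
pose x n := hw (prefix_word w n) 0.
have le01 : 0 <= (0 : R) <= 1 by rewrite lexx ler01.
have x01 : (x @ \oo) `[0, 1]%classic.
  by exists 0%N => // n _ /=; rewrite in_itv; exact: inv_branch_word_itv.
have [y [_]] := @segment_compact _ 0 1 _ _ x01.
rewrite clusterE => hy; exists y => n _.
rewrite (iffLR (closure_id _) (cylinder_image_closed (u := prefix_word w n))).
apply: hy; exists n => // k /= nk.
exists (hw (prefix_word (iter n shift w) (k - n)) 0).
  by rewrite /= in_itv; exact: inv_branch_word_itv.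
by rewrite -inv_branch_word_cat -prefix_wordD subnKC.
Qed.

Lemma codingP w n : exists2 p, 0 <= p <= 1 & hw (prefix_word w n) p = coding F w.
Proof.
by have [p] := getPex (coding_ex w) n I; rewrite /= in_itv; exists p.
Qed.

Lemma coding_itv w : 0 <= coding F w <= 1.
Proof. by have [p p01 <-] := codingP w 0. Qed.

Lemma coding_unique w x :
  (forall n, exists2 p, 0 <= p <= 1 & hw (prefix_word w n) p = x) ->
  x = coding F w.
Proof.
move=> hx; apply/eqP; rewrite -subr_eq0 -normr_le0 leNgt; apply/negP => d0.
have [r r01 hr] := inv_branch_word_contracts F.
have [n rn] := exprn_small r01 d0.
have [p p01 hp] := hx n; have [q q01 hq] := codingP w n.
have := hr (prefix_word w n) _ _ p01 q01; rewrite hp hq size_prefix_word.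
rewrite leNgt => /negP; apply; apply: le_lt_trans rn.
by rewrite ler_piMr ?exprn_ge0// ?ler_norml; lra.
Qed.

Lemma coding_shift w : coding F w = inv_branch F (w 0%N) (coding F (shift w)).
Proof.
apply/esym/coding_unique => -[|n].
  exists (inv_branch F (w 0%N) (coding F (shift w))) => //.
  exact/inv_branch_itv/coding_itv.
have [p p01 hp] := codingP (shift w) n; exists p => //.
by rewrite -hp (prefix_wordD w 1 n).
Qed.

Lemma coding_iter w n :
  coding F w = hw (prefix_word w n) (coding F (iter n shift w)).
Proof.
elim: n => // n IH; rewrite -[X in prefix_word w X]addn1 prefix_wordD.
by rewrite inv_branch_word_cat IH coding_shift /= iter_shift addn0.
Qed.

End Coding.

(** * The lift in symbolic coordinates *)

Section Dynamics.
Context {R : realType} {m : nat} (F : expanding_interval_map R m).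
Variable Psi : R -> int.
Hypothesis hPsi : constant_on_branches F Psi.
Implicit Types (w : nat -> 'I_m) (k : int).

Local Notation shift := Defs.shift.
Local Notation lift := Defs.lift.

Lemma coding_oo w : ~ endpoints F (coding F w) -> 0 < coding F w < 1.
Proof.
move=> nw; have /andP[c0 c1] := coding_itv F w.
have ne x : x = 0 \/ x = 1 -> coding F w != x.
  by move=> x01; apply/eqP => e; apply: nw; exists [::] => //=; exists x.
have n0 := ne 0 (or_introl erefl); have n1 := ne 1 (or_intror erefl).
by rewrite !lt_neqAle c0 c1 eq_sym n0 n1.
Qed.

Lemma coding_shift_not_endpoint w :
  ~ endpoints F (coding F w) -> ~ endpoints F (coding F (shift w)).
Proof.
move=> nw [u _ [x x01 hx]]; apply: nw; exists (w 0%N :: u) => //.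
by exists x => //=; rewrite hx [RHS]coding_shift.
Qed.

(** In the coordinates [(w, k)] the lift is a skew product: shift the sequence and add the step to
    the integer part. *)
Lemma lift_coding w k : ~ endpoints F (coding F w) ->
  lift F Psi (coding F w + k%:~R)
    = coding F (shift w) + (k + step_length F Psi w)%:~R.
Proof.
move=> nw; have /andP[c0 c1] := coding_oo nw.
have s01 := coding_oo (coding_shift_not_endpoint nw).
have dw : eim_dom F (w 0%N) (coding F w).
  by rewrite coding_shift; exact: inv_branch_dom.
rewrite /lift; set f := (X in \sum_(j \in _) X j).
(* The fractional point is strictly inside the unit interval, so only the translate by [k]
   contributes. *)
have -> : \sum_(j \in [set: int]) f j = f k.
  rewrite -(@fsbig_widen _ _ _ _ [set k] setT f) ?fsbig_set1//.
  move=> j [_ jk] /=; rewrite /f indicE memNset ?mulr0//= in_itv/=.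
  rewrite -addrA -intrB => /andP[j0 j1].
  have [d0|d0|d0] := ltgtP (k - j) 0; last first.
  - by apply: jk; apply/esym/eqP; rewrite -subr_eq0 d0.
  - have : (1 : R) <= (k - j)%:~R by rewrite ler1z -gtz0_ge1.
    by move: j0 j1; lra.
  - have : (k - j)%:~R <= -1 :> R.
      by rewrite -(intrN R 1) ler_int -ltzD1 addNr.
    by move: j0 j1; lra.
rewrite /f addrK indicE mem_set ?mulr1/= ?in_itv/= ?ltW//.
have -> : Psi (coding F w) = step_length F Psi w.
  rewrite /step_length; case: xgetP => [_ _ [z dz <-]|/(_ (Psi (coding F w)))].
    exact: hPsi dw dz.
  by case; exists (coding F w).
rewrite -(eim_branchE dw) {1}coding_shift.
have [_ ->] := inv_branchP F (w 0%N) (coding_itv F (shift w)).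
by rewrite intrD; ring.
Qed.

(** The step depends on the first letter only, so the constant sequence [fun=> w j] stands for the
    letter [w j]. *)
Lemma iter_lift_coding w k n : ~ endpoints F (coding F w) ->
  iter n (lift F Psi) (coding F w + k%:~R) = coding F (iter n shift w)
    + (k + \sum_(j < n) step_length F Psi (fun=> w j))%:~R.
Proof.
elim: n w k => [|n IH] w k nw; first by rewrite big_ord0 addr0.
rewrite !iterSr lift_coding// IH; last exact: coding_shift_not_endpoint.
by rewrite big_ord_recl addrA.
Qed.

End Dynamics.

(** * Birkhoff sums over cylinders *)

Section WordSums.
Context {R : realType} {m : nat} (F : expanding_interval_map R m).
Variable (i0 : 'I_m).
Implicit Types (w : nat -> 'I_m) (u : seq 'I_m).

Local Notation shift := Defs.shift.

Lemma cylinder_nonempty u : cylinder u !=set0.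
Proof. by exists (nth i0 u); rewrite /cylinder/= /prefix_word mkseq_nth. Qed.

(** The Birkhoff sum is constant on the cylinder, so the supremum is over a singleton. *)
Lemma word_sum_letter (g : 'I_m -> R) u :
  word_sum (fun w => g (w 0%N)) u = \sum_(i <- u) g i.
Proof.
rewrite /word_sum.
have bE w : cylinder u w ->
    birkhoff_sum (fun w => g (w 0%N)) (size u) w = \sum_(i <- u) g i.
  move=> <-; rewrite size_prefix_word /birkhoff_sum /prefix_word big_map.
  rewrite -[in RHS](subn0 (size u)) [RHS]big_mkord.
  by apply: eq_bigr => k _; rewrite iter_shift addn0.
have [w uw] := cylinder_nonempty u.
rewrite (_ : [set _ | _ in _] = [set \sum_(i <- u) g i]) ?sup1//.
apply/seteqP; split=> [_ [v uv <-]|_ ->]; first by rewrite /= bE.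
by exists w => //; exact: bE.
Qed.

Lemma birkhoff_geometric w n : birkhoff_sum (geometric_potential F) n w
  = - log_deriv F (prefix_word w n) (coding F (iter n shift w)).
Proof.
elim: n w => [|n IH] w; first by rewrite /birkhoff_sum big_ord0 oppr0.
rewrite /birkhoff_sum big_ord_recl.
have -> : \sum_(i < n) geometric_potential F (iter (lift ord0 i) shift w)
    = birkhoff_sum (geometric_potential F) n (shift w).
  by apply: eq_bigr => i _; rewrite -iterSr.
have -> : prefix_word w n.+1 = w 0%N :: prefix_word (shift w) n.
  exact: (prefix_wordD w 1 n).
rewrite IH [in RHS]iterSr /= opprD; congr (_ + _).
by rewrite /geometric_potential coding_shift (coding_iter F (shift w) n).
Qed.

(** Every Birkhoff sum on the cylinder is minus a [log_deriv], hence within [ln A] of the logarithm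
    of the cylinder length; the supremum inherits both bounds. *)
Lemma word_sum_geometric : exists2 A : R, 1 <= A & forall u,
  A^-1 * cyl_len F u <= expR (word_sum (geometric_potential F) u)
    <= A * cyl_len F u.
Proof.
have [A A1 hA] := cyl_len_log_deriv F; exists A => // u.
have A0 : 0 < A by apply: lt_le_trans A1.
have l0 := cyl_len_gt0 F u.
set S := [set birkhoff_sum (geometric_potential F) (size u) w | w in cylinder u].
have hS x : S x -> ln (A^-1 * cyl_len F u) <= x <= ln (A * cyl_len F u).
  move=> [w uw <-]; rewrite birkhoff_geometric uw.
  have := hA u _ (coding_itv F (iter (size u) shift w)).
  set G := log_deriv _ _ _ => /andP[h1 h2].
  rewrite -[X in _ <= X <= _]expRK !ler_ln ?posrE ?mulr_gt0 ?invr_gt0 ?expR_gt0//.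
  by rewrite ler_pdivrMl// h2 -ler_pdivrMl// h1.
have S0 : S !=set0.
  have [w uw] := cylinder_nonempty u.
  by exists (birkhoff_sum (geometric_potential F) (size u) w), w.
have uS : has_ubound S.
  by exists (ln (A * cyl_len F u)) => x /hS/andP[].
have /andP[h1 h2] : ln (A^-1 * cyl_len F u) <= sup S <= ln (A * cyl_len F u).
  have [x Sx] := S0; have /andP[x1 x2] := hS _ Sx.
  rewrite (le_trans x1) ?ub_le_sup//=; by apply: ge_sup => // y /hS/andP[_].
rewrite /word_sum -/S.
rewrite -ler_expR lnK ?posrE ?mulr_gt0 ?invr_gt0// in h1.
rewrite -ler_expR lnK ?posrE ?mulr_gt0// in h2.
by rewrite h1 h2.
Qed.

End WordSums.

(** * Series over words *)

Section ExtendedSums.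
Local Open Scope ereal_scope.
Context {R : realType}.

Lemma esum_le_scale (T : choiceType) (D : set T) (f g : T -> \bar R) (c : R) :
  (0 <= c)%R -> (forall x, 0 <= g x) ->
  (forall x, D x -> f x <= c%:E * g x) ->
  \esum_(x in D) f x <= c%:E * \esum_(x in D) g x.
Proof.
move=> c0 g0 fg; apply: ge_ereal_sup => _ [X [finX XD] <-].
apply: (@le_trans _ _ (\sum_(x \in X) c%:E * g x)).
  by apply: lee_fsum => // x /XD /fg.
rewrite -ge0_mule_fsumr// lee_wpmul2l ?lee_fin//.
by apply: esum_ge; exists X.
Qed.

Lemma esum_le_inj (T T' : choiceType) (D : set T) (D' : set T') (e : T -> T')
    (f : T -> \bar R) (g : T' -> \bar R) :
  {in D &, injective e} -> (forall x, D x -> D' (e x)) ->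
  (forall y, D' y -> 0 <= g y) -> (forall x, D x -> f x <= g (e x)) ->
  \esum_(x in D) f x <= \esum_(y in D') g y.
Proof.
move=> inj eD g0 fg; apply: (le_trans (le_esum fg)).
rewrite -(esum_image D e g inj) (esumID (e @` D) D')//.
rewrite (setIidr (_ : e @` D `<=` D')); last by move=> _ [x Dx <-]; exact: eD.
by rewrite leeDl// esum_ge0// => y [/g0].
Qed.

(** The [V j] may overlap: on [D] the function is at most the sum of its restrictions to them. *)
Lemma esum_le_cover (T : choiceType) (J : finType) (D : set T) (V : J -> set T)
    (f : T -> \bar R) : (forall x, 0 <= f x) ->
  (forall x, D x -> exists j, V j x) ->
  \esum_(x in D) f x <= \sum_j \esum_(x in V j) f x.
Proof.
move=> f0 DV.
apply: (@le_trans _ _ (\esum_(x in D) \sum_j (if x \in V j then f x else 0))).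
  apply: le_esum => x /DV[j Vjx]; rewrite (bigD1 j)//= mem_set// leeDl//.
  by apply: sume_ge0 => k _; case: ifP.
rewrite esum_sum; last by move=> x j _ _; case: ifP.
apply: lee_sum => j _; rewrite [leRHS]esum_mkcond.
by apply: (@esum_le_inj _ _ _ _ id) => // x; case: ifP.
Qed.

End ExtendedSums.

Lemma ler_sum_uniq {R : numDomainType} (T : eqType) (s1 s2 : seq T) (f : T -> R) :
  (forall x, 0 <= f x) -> uniq s1 -> uniq s2 -> {subset s1 <= s2} ->
  \sum_(x <- s1) f x <= \sum_(x <- s2) f x.
Proof.
move=> f0 u1 u2 s12; rewrite [leRHS](bigID (fun x => x \in s1))/=.
rewrite -[X in _ <= X + _]big_filter.
have p12 : perm_eq [seq x <- s2 | x \in s1] s1.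
  apply: uniq_perm; rewrite ?filter_uniq// => x; rewrite mem_filter.
  by case: (boolP (x \in s1)) => // /s12 ->.
by rewrite (perm_big _ p12) lerDl sumr_ge0.
Qed.

Lemma geometric_sum_le {R : realFieldType} (q : R) n : 0 <= q -> q < 1 ->
  \sum_(i < n) q ^+ i <= (1 - q)^-1.
Proof.
move=> q0 q1; have d0 : 0 < 1 - q by rewrite subr_gt0.
rewrite -[leRHS]mul1r ler_pdivlMr// mulrC -opprB mulNr -subrX1 opprB.
by rewrite gerBl exprn_ge0.
Qed.

(** * Series of an almost multiplicative weight on words *)

Section WordSeries.
Context {R : realType} {I : finType} (l : seq I -> R) (A r : R).
Hypotheses (l_gt0 : forall u, 0 < l u) (A_ge1 : 1 <= A).
Hypothesis l_cat : forall u v,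
  A^-1 * (l u * l v) <= l (u ++ v) <= A * (l u * l v).
Hypotheses (r01 : 0 < r < 1) (l_exp : forall u, l u <= r ^+ size u).
Implicit Types (W V : set (seq I)) (u v : seq I).

Definition word_series (s : R) W : \bar R := \esum_(u in W) (l u `^ s)%:E.

Lemma l_le1 u : l u <= 1.
Proof.
have /andP[r0 r1] := r01.
by apply: (le_trans (l_exp u)); rewrite exprn_ile1 ?ltW.
Qed.

Lemma word_series_subset s W V : W `<=` V ->
  (word_series s W <= word_series s V)%E.
Proof.
by move=> WV; apply: (@esum_le_inj _ _ _ _ _ id) => // u; rewrite lee_fin powR_ge0.
Qed.

Lemma word_series_cover s (J : finType) W (V : J -> set (seq I)) :
  (forall u, W u -> exists j, V j u) ->
  (forall j, word_series s (V j) < +oo)%E -> (word_series s W < +oo)%E.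
Proof.
move=> WV Vfin; apply: le_lt_trans (esum_le_cover _ WV) _.
  by move=> u; rewrite lee_fin powR_ge0.
by apply: lte_sum_pinfty => j _; exact: Vfin.
Qed.

(** Appending [a] is injective and shrinks the weight by at most the factor [l [:: a] / A]. *)
Lemma word_series_rcons s W a : 0 <= s -> (word_series s W < +oo)%E ->
  (word_series s [set u | W (rcons u a)] < +oo)%E.
Proof.
move=> s0 Wfin.
have A0 : 0 < A by apply: lt_le_trans A_ge1.
pose c := (A / l [:: a]) `^ s.
have c0 : 0 <= c := powR_ge0 _ _.
have le1 : (word_series s [set u | W (rcons u a)] <=
    c%:E * \esum_(u in [set u | W (rcons u a)]) (l (rcons u a) `^ s)%:E)%E.
  apply: esum_le_scale => // u; first by rewrite lee_fin powR_ge0.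
  move=> _; have la := l_gt0 [:: a]; have lu := l_gt0 u.
  have lua := l_gt0 (rcons u a).
  have Al : 0 < A / l [:: a] by rewrite divr_gt0.
  rewrite -EFinM lee_fin -powRM ?(ltW Al) ?(ltW lua)//.
  rewrite ge0_ler_powR// ?nnegrE ?(ltW (mulr_gt0 _ _)) ?(ltW lu)//.
  have /andP[+ _] := l_cat u [:: a]; rewrite cats1 ler_pdivrMl// => h.
  by rewrite mulrAC ler_pdivlMr.
apply: (le_lt_trans le1); rewrite lte_mul_pinfty ?lee_fin//.
apply: le_lt_trans Wfin.
apply: (@esum_le_inj _ _ _ _ _ (rcons^~ a)) => //.
  by move=> u v _ _ /rcons_inj[].
by move=> u _; rewrite lee_fin powR_ge0.
Qed.

(** The weight of [u] is at most [A * A] times the product of the weights of [p] and [q], so the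
    series is dominated by a product of two finite ones. *)
Lemma word_series_concat s V1 b V2 : 0 <= s ->
  (word_series s V1 < +oo)%E -> (word_series s V2 < +oo)%E ->
  (word_series s [set u | exists p q, [/\ V1 p, V2 q & u = p ++ b :: q]%SEQ]
     < +oo)%E.
Proof.
move=> s0 V1fin V2fin; set W := [set u | _].
have A0 : 0 < A by apply: lt_le_trans A_ge1.
(* A word may split in several ways; one splitting is chosen, and it determines the word. *)
have /choice[e he] : forall u, exists e : seq I * seq I,
    W u -> [/\ V1 e.1, V2 e.2 & u = e.1 ++ b :: e.2]%SEQ.
  move=> u; have [[p [q hpq]]|nW] := pselect (W u); first by exists (p, q).
  by exists ([::], [::]) => /nW.
pose c := (A * A) `^ s.
have pw_ge0 (x : R) : 0 <= x `^ s := powR_ge0 _ _.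
have hl u : W u -> l u <= A * A * (l (e u).1 * l (e u).2).
  move=> /he[_ _ {1}->]; set p := (e u).1; set q := (e u).2.
  have /andP[_ h1] := l_cat p (b :: q).
  have /andP[_ h2] := l_cat [:: b] q.
  apply: (le_trans h1); rewrite -!mulrA ler_wpM2l ?(ltW A0)//.
  rewrite mulrCA ler_wpM2l ?(ltW (l_gt0 _))//.
  apply: (le_trans h2); rewrite ler_wpM2l ?(ltW A0)//.
  by rewrite ler_piMl ?l_le1// ltW.
have le1 : (word_series s W <= \esum_(k in V1 `*` V2)
    (c%:E * ((l k.1 `^ s)%:E * (l k.2 `^ s)%:E)))%E.
  apply: (@esum_le_inj _ _ _ _ _ e).
  - move=> u v /set_mem/he[_ _ eu] /set_mem/he[_ _ ev] euv.
    by rewrite eu ev euv.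
  - by move=> u /he[].
  - by move=> k _; rewrite -!EFinM lee_fin !mulr_ge0 ?pw_ge0.
  move=> u Wu; rewrite -!EFinM lee_fin.
  have p0 := l_gt0 (e u).1; have q0 := l_gt0 (e u).2.
  rewrite -!powRM ?mulr_ge0 ?(ltW A0) ?(ltW p0) ?(ltW q0)//.
  rewrite ge0_ler_powR ?nnegrE ?mulr_ge0 ?(ltW A0) ?(ltW p0) ?(ltW q0)//.
    exact: ltW.
  exact: hl.
have pq0 (k : seq I * seq I) : (0 <= (l k.1 `^ s)%:E * (l k.2 `^ s)%:E)%E.
  by rewrite -EFinM lee_fin mulr_ge0 ?pw_ge0.
have le2 := @esum_le_scale _ _ (V1 `*` V2) _ _ c (pw_ge0 _) pq0 (fun k _ => lexx _).
apply: (le_lt_trans le1); apply: (le_lt_trans le2).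
rewrite lte_mul_pinfty ?lee_fin ?pw_ge0//.
rewrite -(@esum_esum _ _ _ V1 (fun=> V2)
  (fun p q => (l p `^ s)%:E * (l q `^ s)%:E)%E); last first.
  by move=> p q _ _; rewrite -EFinM lee_fin mulr_ge0 ?pw_ge0.
have V2E : word_series s V2 \is a fin_num.
  by rewrite ge0_fin_numE// esum_ge0// => u _; rewrite lee_fin pw_ge0.
have Z0 : (0 <= word_series s V2)%E by apply: esum_ge0 => u _; rewrite lee_fin pw_ge0.
apply: (@le_lt_trans _ _ (\esum_(p in V1)
    (fine (word_series s V2))%:E * (l p `^ s)%:E)%E).
  apply: le_esum => p _; rewrite fineK// muleC.
  by apply: esum_le_scale => // q; rewrite lee_fin pw_ge0.
have p0 (p : seq I) : (0 <= (l p `^ s)%:E)%E by rewrite lee_fin pw_ge0.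
have le3 := @esum_le_scale _ _ V1 _ _ _ (fine_ge0 Z0) p0 (fun p _ => lexx _).
apply: (le_lt_trans le3).
by rewrite lte_mul_pinfty ?lee_fin ?fine_ge0.
Qed.

Definition words_of_size W n : seq (seq I) :=
  [seq u <- map val (enum {:n.-tuple I}) | `[< W u >]].

Lemma mem_words_of_size W n u :
  (u \in words_of_size W n) = (size u == n) && `[< W u >].
Proof.
rewrite mem_filter andbC; congr (_ && _); apply/mapP/eqP.
  by move=> [t _ ->]; rewrite size_tuple.
by move=> /eqP su; exists (Tuple su); rewrite ?mem_enum.
Qed.

Lemma uniq_words_of_size W n : uniq (words_of_size W n).
Proof. by rewrite filter_uniq// map_inj_uniq ?enum_uniq//; exact: val_inj. Qed.

(** Since [l u]^ s[is at most]q ^+ size u * l u [^ t] with [q < 1], a bound [M] on the [t]-mass of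
    all levels would bound the whole series at [s] by [M / (1 - q)]. *)
Lemma word_series_level s t M W : 0 <= t -> t < s -> word_series s W = +oo%E ->
  exists n, M <= \sum_(u <- words_of_size W n) l u `^ t.
Proof.
move=> t0 ts Woo; apply: contrapT => /forallNP hM.
have {}hM n : \sum_(u <- words_of_size W n) l u `^ t <= M.
  by have /negP := hM n; rewrite -ltNge => /ltW.
have /andP[r0 r1] := r01.
have M0 : 0 <= M.
  by apply: le_trans (hM 0%N); apply: sumr_ge0 => u _; exact: powR_ge0.
pose q := r `^ (s - t).
have q0 : 0 < q by exact: powR_gt0.
have q1 : q < 1.
  have -> : 1 = 1 `^ (s - t) :> R by rewrite powR1.
  by rewrite gt0_ltr_powR ?subr_gt0// ?nnegrE ltW.
have hq u : l u `^ s <= q ^+ size u * l u `^ t.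
  have -> : s = (s - t) + t by rewrite subrK.
  rewrite powRD; last by apply/implyP => _; rewrite gt_eqF.
  rewrite ler_wpM2r ?powR_ge0// -powR_mulrn ?(ltW q0)// -powRrM mulrC powRrM.
  rewrite powR_mulrn ?(ltW r0)//.
  rewrite ge0_ler_powR ?nnegrE ?subr_ge0 ?exprn_ge0 ?(ltW ts) ?(ltW r0)//.
  exact: ltW.
suff : (word_series s W <= (M / (1 - q))%:E)%E by rewrite Woo.
apply: ge_ereal_sup => _ [X [finX XW] <-].
rewrite fsumEFin// lee_fin fsbig_finite//=.
(* A finite partial sum is split by word length; [N] exceeds every length in it, so [inord] loses
   nothing. *)
set Y := finmap.enum_fset (fset_set X); pose N := (\max_(u <- Y) size u).+1.
have sN u : u \in Y -> (size u < N)%N.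
  by move=> uY; rewrite ltnS; exact: leq_bigmax_seq.
rewrite big_seq (partition_big (fun u => inord (size u)) (xpredT : pred 'I_N))//=.
apply: (@le_trans _ _ (\sum_(n < N) q ^+ n * M)).
  apply: ler_sum => n _.
  apply: (@le_trans _ _ (q ^+ n * \sum_(u <- words_of_size W n) l u `^ t)); last first.
    by rewrite ler_wpM2l ?exprn_ge0 ?(ltW q0).
  rewrite mulr_sumr.
  apply: (@le_trans _ _
      (\sum_(u <- Y | (u \in Y) && (inord (size u) == n)) q ^+ n * l u `^ t)).
    by apply: ler_sum => u /andP[uY /eqP <-]; rewrite inordK ?sN.
  rewrite -[leLHS]big_filter; apply: ler_sum_uniq.
  - by move=> u; rewrite mulr_ge0 ?exprn_ge0 ?powR_ge0 ?(ltW q0).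
  - by rewrite filter_uniq// finmap.fset_uniq.
  - exact: uniq_words_of_size.
  move=> u; rewrite mem_filter => /andP[/andP[uY /eqP <-] _].
  rewrite mem_words_of_size inordK ?sN// eqxx/=; apply/asboolP/XW.
  by apply: set_mem; rewrite -(in_fset_set finX).
rewrite -mulr_suml mulrC ler_wpM2l//; exact: geometric_sum_le (ltW q0) q1.
Qed.

End WordSeries.

Lemma le_mulrn_ex {R : archiRealFieldType} (x d : R) : 0 < d ->
  exists n, x <= d *+ n.
Proof.
move=> d0; exists (Num.trunc (x / d)).+1.
by rewrite -mulr_natl -ler_pdivrMr// ltW// truncnS_gt.
Qed.

(** * Balanced words and steering of letter sums *)

Section Steering.
Context {R : realType} {I : finType} (l : seq I -> R) (A r : R).
Hypotheses (l_gt0 : forall u, 0 < l u) (A_ge1 : 1 <= A).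
Hypothesis l_cat : forall u v,
  A^-1 * (l u * l v) <= l (u ++ v) <= A * (l u * l v).
Hypotheses (r01 : 0 < r < 1) (l_exp : forall u, l u <= r ^+ size u).
Implicit Types (g : I -> R) (u v : seq I).

Local Notation S g u := (\sum_(i <- u) g i).
Local Notation Z s W := (word_series l s W).

Definition balanced_words g (K : R) : set (seq I) := [set u | `|S g u| <= K].

Definition neutral_words g : set (seq I) := [set u | all (fun i => g i == 0) u].

(* Blocks from [E] can be concatenated with bounded letter sum, provided that
   each is preceded by [c_down] or [c_up] according to the sign of the sum so
   far. If [g] has constant sign, [K = 0] and both correcting words are empty. *)
Definition steerable g (t : R) : Prop := exists K c_up c_down,
  [/\ K <= S g c_up, S g c_down <= - K &
      forall M, exists (E : seq (seq I)) (n : nat), [/\ uniq E,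
        forall u, u \in E -> size u = n /\ `|S g u| <= K &
        M <= \sum_(u <- E) l u `^ t]].

Lemma balanced_words_le g K K' : K <= K' ->
  balanced_words g K `<=` balanced_words g K'.
Proof. by move=> KK u /= /le_trans; apply. Qed.

Lemma balanced_wordsN g K :
  balanced_words (fun i => - g i) K = balanced_words g K.
Proof.
by apply/seteqP; split=> u; rewrite /balanced_words/= sumrN normrN.
Qed.

(** The bound is widened in steps of [d], the smaller of the two step sizes. A word that exceeds
    [Kn] by at most [d] returns to the old range on appending [a], or [b] on the negative side; it
    cannot overshoot, as both steps are at most [K]. *)
Lemma word_series_widen g a b s K K' : g a < 0 -> 0 < g b -> 0 <= s ->
  - g a <= K -> g b <= K -> (Z s (balanced_words g K) < +oo)%E ->
  (Z s (balanced_words g K') < +oo)%E.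
Proof.
move=> ga gb s0 aK bK Kfin.
pose d := Num.min (- g a) (g b).
have d0 : 0 < d by rewrite lt_min oppr_gt0 ga.
have [n hn] : exists n : nat, K' <= K + d *+ n.
  by have [n hn] := le_mulrn_ex (K' - K) d0; exists n; rewrite -lerBlDl.
apply: (le_lt_trans (word_series_subset _ _ (balanced_words_le hn))) => {K' hn}.
elim: n => [|n IH]; first by rewrite addr0.
set Kn := K + d *+ n in IH; rewrite mulrSr addrA -/Kn.
have KKn : K <= Kn by rewrite lerDl mulrn_wge0// ltW.
have [da db] : d <= - g a /\ d <= g b by split; rewrite ge_min lexx ?orbT.
pose V (j : option bool) := match j with
  | None => balanced_words g Kn
  | Some c => [set u | balanced_words g Kn (rcons u (if c then a else b))] end.
apply: (word_series_cover (V := V)).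
  move=> u; rewrite /balanced_words/= ler_norml => /andP[u1 u2].
  have Srcons c : S g (rcons u c) = S g u + g c by rewrite -cats1 big_cat big_seq1.
  have [h1|h1] := lerP (S g u) Kn; last first.
    by exists (Some true); rewrite /= /balanced_words/= Srcons ler_norml; lra.
  have [h2|h2] := lerP (- Kn) (S g u).
    by exists None; rewrite /= /balanced_words/= ler_norml h2.
  by exists (Some false); rewrite /= /balanced_words/= Srcons ler_norml; lra.
by case=> [c|//]; exact: (word_series_rcons l_gt0 A_ge1 l_cat).
Qed.

(** With [c] a positive lower bound for the nonzero values of [g], a balanced word has at most
    [K / c] letters with nonzero value. Cutting at the first such letter leaves a neutral word and a
    word with one fewer, so induction on their number applies. *)
Lemma word_series_one_sided g s K : (forall i, 0 <= g i) -> 0 <= s ->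
  (Z s (neutral_words g) < +oo)%E ->
  (Z s (balanced_words g K) < +oo)%E.
Proof.
move=> g0 s0; set G := neutral_words g => Gfin.
pose bad i := g i != 0.
pose V n := [set u | (count bad u <= n)%N].
have Vfin n : (Z s (V n) < +oo)%E.
  elim: n => [|n IH].
    apply: le_lt_trans Gfin; apply: word_series_subset => u.
    rewrite /V /G /neutral_words /=.
    rewrite leqn0 -[_ == _]negbK -lt0n -has_count -all_predC.
    by apply: sub_all => i /=; rewrite negbK.
  pose V' (j : option I) := if j is Some b
    then [set u | exists p q, [/\ G p, V n q & u = p ++ b :: q]%SEQ] else G.
  apply: (word_series_cover (V := V')); last first.
    by case=> [b|//]; exact: (word_series_concat l_gt0 A_ge1 l_cat r01 l_exp).
  move=> u Vu; have [hb|nb] := boolP (has bad u); last first.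
    exists None => /=; move: nb; rewrite -all_predC; apply: sub_all => i /=.
    by rewrite negbK.
  have [i0 _] : exists i0 : I, true by move/hasP: hb => [i _ _]; exists i.
  pose k := find bad u.
  have ku : (k < size u)%N by rewrite -has_find.
  have uE : u = (take k u ++ nth i0 u k :: drop k.+1 u)%SEQ.
    by rewrite -drop_nth// cat_take_drop.
  have tG : all (fun i => g i == 0) (take k u).
    apply/(all_nthP i0) => j; rewrite size_take ku => jk.
    by rewrite nth_take//; have := before_find i0 jk => /negbFE.
  exists (Some (nth i0 u k)), (take k u), (drop k.+1 u); split=> //.
  have badk : bad (nth i0 u k) by exact: nth_find.
  move: Vu; rewrite /V/= {1}uE count_cat/= badk.
  by rewrite addnCA add1n ltnS; apply: leq_trans; exact: leq_addl.
have [c c0 hc] : exists2 c : R, 0 < c & forall i, bad i -> c <= g i.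
  exists (\big[Num.min/1]_(i | bad i) g i).
    by apply: lt_bigmin => // i bi; rewrite lt_neqAle eq_sym g0 andbT.
  by move=> i bi; exact: bigmin_le_cond.
have cS u : c * (count bad u)%:R <= S g u.
  elim: u => [|i u IH]; first by rewrite big_nil mulr0.
  rewrite big_cons /= natrD mulrDr lerD//.
  by have [/hc|] := boolP (bad i); rewrite ?mulr1 ?mulr0.
apply: le_lt_trans (Vfin (Num.trunc (K / c))); apply: word_series_subset => u /=.
rewrite /balanced_words/= => /(le_trans (ler_norm _))/(le_trans (cS u)) h.
have K0 : 0 <= K / c.
  by rewrite divr_ge0 ?(ltW c0)// (le_trans _ h)// mulr_ge0 ?(ltW c0).
by rewrite /V/= truncn_ge_nat// ler_pdivlMr// mulrC.
Qed.

(** Divergence passes to the neutral words, whose letter sum is 0; nothing has to be corrected. *)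
Lemma steerable_one_sided g s t K : (forall i, 0 <= g i) -> 0 <= t -> t < s ->
  Z s (balanced_words g K) = +oo%E -> steerable g t.
Proof.
move=> g0 t0 ts Koo; have s0 : 0 <= s by rewrite ltW// (le_lt_trans t0).
exists 0, [::], [::]; rewrite big_nil oppr0; split=> // M.
pose G := neutral_words g.
have Goo : Z s G = +oo%E.
  apply/eqP; rewrite -leye_eq leNgt; apply/negP => Gfin.
  by have := word_series_one_sided K g0 s0 Gfin; rewrite Koo ltxx.
have [n hn] := word_series_level l_gt0 r01 l_exp M t0 ts Goo.
exists (words_of_size G n), n; split=> //; first exact: uniq_words_of_size.
move=> u; rewrite mem_words_of_size => /andP[/eqP -> /asboolP Gu]; split=> //.
rewrite big_seq big1 ?normr0// => i iu; apply/eqP.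
by move/allP: Gu; apply.
Qed.

Lemma steerable_two_sided g a b s t K : g a < 0 -> 0 < g b -> 0 <= t -> t < s ->
  Z s (balanced_words g K) = +oo%E -> steerable g t.
Proof.
move=> ga gb t0 ts Koo.
have Sn c n : S g (nseq n c) = g c *+ n by rewrite big_nseq iter_addr_0.
have [p hp] := le_mulrn_ex K gb.
have [q hq] : exists q : nat, K <= - g a *+ q by apply: le_mulrn_ex; rewrite oppr_gt0.
exists K, (nseq p b), (nseq q a); rewrite !Sn; split=> //.
  by rewrite lerNr -mulNrn.
move=> M; have [n hn] := word_series_level l_gt0 r01 l_exp M t0 ts Koo.
exists (words_of_size (balanced_words g K) n), n.
split=> //; first exact: uniq_words_of_size.
by move=> u; rewrite mem_words_of_size => /andP[/eqP -> /asboolP].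
Qed.

Lemma steerableN g t : steerable (fun i => - g i) t -> steerable g t.
Proof.
move=> [K [cu [cd [hu hd hE]]]]; exists K, cd, cu; split.
- by move: hd; rewrite sumrN lerN2.
- by move: hu; rewrite sumrN lerNr.
move=> M; have [E [n [uE hEu ME]]] := hE M; exists E, n; split=> // u /hEu.
by rewrite sumrN normrN.
Qed.

(** This fixes how large [K] must be. The first half serves the upper bound for the dimension, the
    second the lower bound. The cases are [g] nonnegative, [g] nonpositive (by negation), and both
    signs, where [g b - g a] dominates both steps. *)
Lemma balanced_words_dichotomy g : exists2 K0 : R, 0 < K0 & forall K, K0 <= K ->
  (forall s K', 0 <= s -> (Z s (balanced_words g K) < +oo)%E ->
     (Z s (balanced_words g K') < +oo)%E) /\
  (forall s t, 0 <= t -> t < s -> Z s (balanced_words g K) = +oo%E ->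
     steerable g t).
Proof.
have one_sided g' : (forall i, 0 <= g' i) -> forall K, 1 <= K ->
    (forall s K', 0 <= s -> (Z s (balanced_words g' K) < +oo)%E ->
       (Z s (balanced_words g' K') < +oo)%E) /\
    (forall s t, 0 <= t -> t < s -> Z s (balanced_words g' K) = +oo%E ->
       steerable g' t).
  move=> g0 K K1; split; last by move=> s t; exact: steerable_one_sided.
  move=> s K' s0 Kfin; apply: word_series_one_sided => //.
  apply: le_lt_trans Kfin; apply: word_series_subset => u /allP u0.
  rewrite /balanced_words/= big_seq big1 ?normr0 ?(le_trans ler01)// => i iu.
  by apply/eqP/u0.
have [gpos|/existsNP[a /negP]] := pselect (forall i, 0 <= g i).
  by exists 1 => // K; exact: one_sided.
rewrite -ltNge => ga.
have [gneg|/existsNP[b /negP]] := pselect (forall i, g i <= 0).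
  exists 1 => // K K1; have [|h1 h2] := one_sided (fun i => - g i) _ _ K1.
    by move=> i; rewrite oppr_ge0.
  split=> s K'; first by have := h1 s K'; rewrite !balanced_wordsN.
  move=> t0 ts; have := h2 s K' t0 ts; rewrite balanced_wordsN => h3 h4.
  by apply: steerableN; exact: h3.
rewrite -ltNge => gb.
exists (g b - g a); first by lra.
move=> K hK; split; last by move=> s t; exact: (steerable_two_sided ga gb).
move=> s K' s0; have [aK bK] : - g a <= K /\ g b <= K by lra.
exact: (word_series_widen K' ga gb s0 aK bK).
Qed.

End Steering.

(** * Null sets from covers by cylinders *)

Section HausdorffNull.
Context {R : realType}.
Implicit Types (A E : set R) (s d : R).

Lemma diam_le A d : (forall x y, A x -> A y -> `|x - y| <= d) ->
  (diam A <= d%:E)%E.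
Proof.
move=> hA; apply: ge_ereal_sup => _ [[x y] /= [Ax Ay] <-].
by rewrite lee_fin; exact: hA.
Qed.

Lemma dist_le_diam A x y : A x -> A y -> (`|x - y|%:E <= diam A)%E.
Proof. by move=> Ax Ay; apply: ereal_sup_ubound; exists (x, y). Qed.

Lemma diam_ge0 A x : A x -> (0 <= diam A)%E.
Proof. by move=> Ax; have := dist_le_diam Ax Ax; rewrite subrr normr0. Qed.

Lemma diam_weight_ge0 s A : (0 <= diam_weight s A)%E.
Proof. by rewrite /diam_weight; case: asboolP => // _; exact: poweR_ge0. Qed.

Lemma diam_weight0 s : diam_weight s set0 = 0%E :> \bar R.
Proof. by rewrite /diam_weight asboolT. Qed.

Lemma diam_weightE s A x : A x -> diam_weight s A = (diam A `^ s)%E.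
Proof. by move=> Ax; rewrite /diam_weight asboolF// => A0; rewrite A0 in Ax. Qed.

Lemma diam_weight_le A s d : 0 <= s ->
  (forall x y, A x -> A y -> `|x - y| <= d) ->
  (diam_weight s A <= (d `^ s)%:E)%E.
Proof.
move=> s0 hA; have [->|/set0P[x Ax]] := eqVneq A set0.
  by rewrite diam_weight0 lee_fin powR_ge0.
rewrite (diam_weightE _ Ax) -poweR_EFin gt0_ler_poweR//.
- by rewrite in_itv/= (diam_ge0 Ax) leey.
- by rewrite in_itv/= lee_fin leey (le_trans _ (hA _ _ Ax Ax)).
- exact: diam_le.
Qed.

Lemma dist_powR_le_weight A s x y : 0 <= s -> A x -> A y ->
  ((`|x - y| `^ s)%:E <= diam_weight s A)%E.
Proof.
move=> s0 Ax Ay; rewrite (diam_weightE _ Ax) -poweR_EFin gt0_ler_poweR//.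
- by rewrite in_itv/= lee_fin normr_ge0 leey.
- by rewrite in_itv/= (diam_ge0 Ax) leey.
- exact: dist_le_diam.
Qed.

Lemma hausdorff_measure_eq0 s E :
  (forall d e, 0 < d -> 0 < e -> (hausdorff_premeasure s d E <= e%:E)%E) ->
  hausdorff_measure s E = 0%E.
Proof.
move=> hE.
have pre0 d : 0 < d -> hausdorff_premeasure s d E = 0%E.
  move=> d0; apply/eqP; rewrite eq_le; apply/andP; split.
    by apply/lee_addgt0Pr => e e0; rewrite add0e; exact: hE.
  apply: le_ereal_inf_tmp => _ [U _ <-].
  by apply: nneseries_ge0 => n _ _; exact: diam_weight_ge0.
rewrite /hausdorff_measure (_ : [set _ | _ in _] = [set 0%E]) ?ereal_sup1//.
apply/seteqP; split=> [_ [d d0 <-]|_ ->]; first by rewrite /= pre0.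
by exists 1; [exact: ltr01|exact: pre0].
Qed.

Lemma hausdorff_premeasure_le (T : countType) (U : T -> set R) s d e E :
  E `<=` \bigcup_t U t -> (forall t, diam (U t) <= d%:E)%E -> 0 <= d ->
  (\esum_(t in [set: T]) diam_weight s (U t) <= e)%E ->
  (hausdorff_premeasure s d E <= e)%E.
Proof.
move=> EU dU d0 sum_e.
pose V n := if @pickle_inv T n is Some t then U t else set0.
have VU t : V (pickle t) = U t by rewrite /V pickleK_inv.
apply: le_trans sum_e; apply: ereal_inf_lbound; exists V; first split.
- by move=> x /EU[t _ Utx]; exists (pickle t) => //; rewrite VU.
- move=> n; rewrite /V; case: pickle_inv => // ; apply: diam_le => x y.
  by [].
rewrite nneseries_esumT; last by move=> n; exact: diam_weight_ge0.
rewrite (_ : \esum_(t in [set: T]) _ =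
  \esum_(t in [set: T]) diam_weight s (V (pickle t)))%E; last first.
  by apply: eq_esum => t _; rewrite VU.
rewrite -(esum_image [set: T] pickle (fun n => diam_weight s (V n))); last first.
  by move=> t t' _ _; exact: (pcan_inj pickleK).
rewrite [RHS]esum_mkcond; apply: eq_esum => n _; case: ifPn => // /negP nn.
rewrite /V; case e1 : pickle_inv => [t|]; last by rewrite diam_weight0.
exfalso; apply: nn; rewrite inE; exists t => //.
by have := @pickle_invK T n; rewrite /ocancel/= e1.
Qed.

End HausdorffNull.

(** * A Borel-Cantelli argument for limsup sets *)

Section LimsupNull.
Context {R : realType} {I : finType} (l : seq I -> R) (r : R).
Hypotheses (r01 : 0 < r < 1) (l_exp : forall u, l u <= r ^+ size u).

(** A finite partial sum comes within [e] of the total; [n] is chosen beyond the length of all its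
    words. *)
Lemma word_series_tail s W e n0 : (word_series l s W < +oo)%E -> 0 < e ->
  exists2 n, (n0 <= n)%N &
    (word_series l s (W `&` [set u | (n <= size u)%N]) <= e%:E)%E.
Proof.
move=> Wfin e0; set a := word_series l s W in Wfin *.
have f0 u : (0 <= (l u `^ s)%:E)%E by rewrite lee_fin powR_ge0.
have afin : a \is a fin_num by rewrite ge0_fin_numE// esum_ge0.
have [_ [X [finX XW] <-] aX] : exists2 x, [set (\sum_(u \in X) (l u `^ s)%:E)%E |
    X in fsets W] x & (a - e%:E < x)%E by exact: ub_ereal_sup_adherent.
pose N := (\max_(u <- finmap.enum_fset (fset_set X)) size u).+1.
pose n := maxn n0 N.
have XN u : X u -> (size u < n)%N.
  move=> Xu; rewrite leq_max; apply/orP; right; rewrite ltnS.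
  have uX := in_fset_set finX u; rewrite mem_set// in uX.
  exact: leq_bigmax_seq uX _.
exists n; first exact: leq_maxl.
have aE : a = (word_series l s (W `&` [set u | (size u < n)%N])
    + word_series l s (W `&` [set u | (n <= size u)%N]))%E.
  rewrite /a /word_series (esumID [set u | (size u < n)%N])//.
  suff -> : ~` [set u : seq I | (size u < n)%N] = [set u | (n <= size u)%N] by [].
  by apply/seteqP; split=> u /=; [move=> /negP; rewrite -leqNgt|rewrite leqNgt => /negP].
have h : (a - e%:E < word_series l s (W `&` [set u | (size u < n)%N]))%E.
  apply: (lt_le_trans aX); apply: esum_ge; exists X => //; split=> // u Xu.
  by split; [exact: XW|exact: XN].
move: h afin; rewrite aE; set x := word_series _ _ _; set y := word_series _ _ _.
have x0 : (0 <= x)%E by apply: esum_ge0.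
have y0 : (0 <= y)%E by apply: esum_ge0.
case: x x0 => [x||]//= _; case: y y0 => [y||]//= _.
by rewrite -?EFinD -?EFinB lte_fin !lee_fin; lra.
Qed.

(** For each [p] the words longer than [n p] already cover, with mass at most
    [e / 2 ^ (pickle p + 1)]; these masses sum to at most [e], and [n0] makes all the diameters at
    most [d]. *)
Lemma limsup_null (P : countType) (W : P -> set (seq I))
    (J : P -> seq I -> set R) s E : 0 <= s ->
  (forall p, word_series l s (W p) < +oo)%E ->
  (forall p u x y, J p u x -> J p u y -> `|x - y| <= l u) ->
  (forall x, E x -> exists p, forall n, exists u,
     [/\ W p u, (n <= size u)%N & J p u x]) ->
  hausdorff_measure s E = 0%E.
Proof.
move=> s0 Wfin Jl EJ; apply: hausdorff_measure_eq0 => d e d0 e0.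
have [n0 hn0] := exprn_small r01 d0.
pose eps (p : P) := e / (2 ^ (pickle p).+1)%:R.
have eps0 p : 0 < eps p by rewrite divr_gt0// ltr0n expn_gt0.
have /choice[n hn] : forall p, exists n, (n0 <= n)%N /\
    (word_series l s (W p `&` [set u | (n <= size u)%N]) <= (eps p)%:E)%E.
  by move=> p; have [n ? ?] := word_series_tail n0 (Wfin p) (eps0 p); exists n.
pose V (k : P * seq I) := if `[< W k.1 k.2 >] && (n k.1 <= size k.2)%N
  then J k.1 k.2 else set0.
apply: (@hausdorff_premeasure_le _ _ V _ _ _ _ _ _ (ltW d0)).
- move=> x /EJ[p /(_ (n p))[u [Wu nu Jx]]]; exists (p, u) => //.
  by rewrite /V/= nu asboolT.
- move=> [p u]; rewrite /V/=.
  case: ifPn => [/andP[_ nu]|_]; apply: diam_le => // x y Jx Jy.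
  apply: (le_trans (Jl _ _ _ _ Jx Jy)); apply: (le_trans (l_exp u)).
  apply: le_trans (ltW hn0); have /andP[r0 r1] := r01.
  by rewrite ler_wiXn2l ?(ltW r0) ?(ltW r1)// (leq_trans (hn p).1).
have -> : [set: P * seq I] = [set: P] `*`` (fun=> [set: seq I]).
  by apply/seteqP; split.
rewrite -(@esum_esum _ _ _ _ _ (fun p u => diam_weight s (V (p, u)))); last first.
  by move=> p u _ _; exact: diam_weight_ge0.
apply: (@le_trans _ _ (\esum_(p in [set: P]) (eps p)%:E)%E).
  apply: le_esum => p _; apply: le_trans (hn p).2.
  rewrite /word_series [leRHS]esum_mkcond; apply: le_esum => u _; rewrite /V/=.
  case: ifPn => [/andP[/asboolP Wu nu]|_]; last first.
    by rewrite diam_weight0; case: ifP; rewrite // lee_fin powR_ge0.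
  by rewrite mem_set//; apply: diam_weight_le => // x y; exact: Jl.
apply: le_trans (epsilon_trick0 xpredT (ltW e0)).
rewrite nneseries_esumT; last by move=> i; rewrite lee_fin divr_ge0// ltW.
apply: (@esum_le_inj _ _ _ _ _ pickle) => //.
by move=> i; rewrite lee_fin divr_ge0 // ltW.
Qed.

End LimsupNull.

(** * Descent in a tree of cylinders *)

Section Descent.
Context {R : realType} {m : nat} (F : expanding_interval_map R m).
Implicit Types (u v : seq 'I_m) (B : set R).

Local Notation hw u := (inv_branch_word F u).
Local Notation l := (cyl_len F).

Definition cyl u : set R := hw u @` `[0, 1].

Lemma cylP u x : cyl u x <-> exists2 p, 0 <= p <= 1 & hw u p = x.
Proof.
by split=> -[p p01 <-]; exists p => //; move: p01; rewrite /= in_itv.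
Qed.

Lemma cyl_cat u v : cyl (u ++ v) `<=` cyl u.
Proof.
move=> x /cylP[p p01 <-]; apply/cylP; exists (hw v p).
  exact: inv_branch_word_itv.
by rewrite inv_branch_word_cat.
Qed.

(** Cylinders of equal word length are ordered on the line, so points in the outer two are at least
    as far apart as the middle one is long. *)
Lemma no_three_siblings u1 u2 u3 B :
  size u1 = size u2 -> size u2 = size u3 -> u1 != u2 -> u2 != u3 -> u1 != u3 ->
  (forall x y, B x -> B y -> [/\ `|x - y| < l u1, `|x - y| < l u2 &
    `|x - y| < l u3]) ->
  B `&` cyl u1 !=set0 -> B `&` cyl u2 !=set0 -> B `&` cyl u3 !=set0 -> False.
Proof.
move=> s12 s23 n12 n23 n13 small [x1 [B1 /cylP[p1 i1 e1]]]
  [x2 [B2 /cylP[p2 i2 e2]]] [x3 [B3 /cylP[p3 i3 e3]]].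
pose L u v := forall p q, 0 <= p <= 1 -> 0 <= q <= 1 -> hw u p <= hw v q.
have path u v w x y p q : L u v -> L v w -> 0 <= p <= 1 -> 0 <= q <= 1 ->
    hw u p = x -> hw w q = y -> l v <= `|x - y|.
  have le00 : 0 <= (0 : R) <= 1 by rewrite lexx ler01.
  have le11 : 0 <= (1 : R) <= 1 by rewrite ler01 lexx.
  move=> uv vw p01 q01 <- <-.
  have := uv _ _ p01 le00; have := uv _ _ p01 le11.
  have := vw _ _ le00 q01; have := vw _ _ le11 q01 => ????.
  by rewrite distrC [leRHS]ger0_norm /cyl_len ?ler_norml; lra.
have contra u v x y : B x -> B y -> l v <= `|x - y| -> v \in [:: u1; u2; u3] -> False.
  move=> Bx By; have [h1 h2 h3] := small _ _ Bx By.
  by rewrite leNgt !inE => /negP + /or3P[] /eqP ve; rewrite ve; apply.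
have in1 : u1 \in [:: u1; u2; u3] by rewrite !inE eqxx.
have in2 : u2 \in [:: u1; u2; u3] by rewrite !inE eqxx orbT.
have in3 : u3 \in [:: u1; u2; u3] by rewrite !inE eqxx !orbT.
have := cylinders_ordered F s12 n12; rewrite -/(L u1 u2).
have := cylinders_ordered F s23 n23; rewrite -/(L u2 u3).
have := cylinders_ordered F (etrans s12 s23) n13; rewrite -/(L u1 u3).
have flip u v : (forall p q, 0 <= p <= 1 -> 0 <= q <= 1 -> hw v q <= hw u p) ->
    L v u by move=> h p q p01 q01; exact: h.
(* Six of the eight patterns are linear orders; the two cyclic ones yield to the same estimate along
   two consecutive relations. *)
move=> [L13|/flip L31] [L23|/flip L32] [L12|/flip L21].
- exact: (contra u1 _ _ _ B1 B3 (path _ _ _ _ _ _ _ L12 L23 i1 i3 e1 e3) in2).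
- exact: (contra u1 _ _ _ B2 B3 (path _ _ _ _ _ _ _ L21 L13 i2 i3 e2 e3) in1).
- exact: (contra u1 _ _ _ B1 B2 (path _ _ _ _ _ _ _ L13 L32 i1 i2 e1 e2) in3).
- exact: (contra u1 _ _ _ B3 B1 (path _ _ _ _ _ _ _ L32 L21 i3 i1 e3 e1) in2).
- exact: (contra u1 _ _ _ B1 B3 (path _ _ _ _ _ _ _ L12 L23 i1 i3 e1 e3) in2).
- exact: (contra u1 _ _ _ B2 B1 (path _ _ _ _ _ _ _ L23 L31 i2 i1 e2 e1) in3).
- exact: (contra u1 _ _ _ B3 B2 (path _ _ _ _ _ _ _ L31 L12 i3 i2 e3 e2) in1).
- exact: (contra u1 _ _ _ B3 B1 (path _ _ _ _ _ _ _ L32 L21 i3 i1 e3 e1) in2).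
Qed.

Variables (kids : seq 'I_m -> seq (seq 'I_m)) (t k : R).
Hypotheses (t_gt0 : 0 < t) (k_gt0 : 0 < k).
Hypothesis kids_uniq : forall v, uniq (kids v).
Hypothesis kids_extend : forall v u, u \in kids v -> exists w, u = v ++ w.
Hypothesis kids_size : forall v u u', u \in kids v -> u' \in kids v ->
  size u = size u'.
Hypothesis kids_len : forall v u, u \in kids v -> k * l v <= l u.
Hypothesis kids_sum : forall v, 3 * l v `^ t <= \sum_(u <- kids v) l u `^ t.

Lemma few_kids_meet v B a : (forall x y, B x -> B y -> `|x - y| `^ t <= a) ->
  a < (k * l v) `^ t -> (count (fun u => `[< B `&` cyl u !=set0 >]) (kids v) <= 2)%N.
Proof.
move=> hB ak; rewrite leqNgt -size_filter; apply/negP.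
set s := [seq u <- kids v | _] => ss.
have us : uniq s by rewrite filter_uniq.
have sP u : u \in s -> u \in kids v /\ B `&` cyl u !=set0.
  by rewrite mem_filter => /andP[/asboolP].
case es : s ss us => [|u1 [|u2 [|u3 s']]]//= _.
rewrite !inE !negb_or => /andP[/and3P[n12 n13 _] /andP[/andP[n23 _] _]].
have [k1 m1] : u1 \in kids v /\ B `&` cyl u1 !=set0.
  by apply: sP; rewrite es !inE eqxx.
have [k2 m2] : u2 \in kids v /\ B `&` cyl u2 !=set0.
  by apply: sP; rewrite es !inE eqxx orbT.
have [k3 m3] : u3 \in kids v /\ B `&` cyl u3 !=set0.
  by apply: sP; rewrite es !inE eqxx !orbT.
apply: (@no_three_siblings u1 u2 u3 B) => //; try exact: (kids_size (v := v)).
move=> x y Bx By; have h u : u \in kids v -> `|x - y| < l u.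
  move=> uv; have lu := cyl_len_gt0 F u; rewrite ltNge; apply/negP => xy.
  have : a < a; last by rewrite ltxx.
  apply: (lt_le_trans ak); apply: le_trans (hB _ _ Bx By).
  have kl : 0 <= k * l v by rewrite mulr_ge0 ?(ltW k_gt0) ?(ltW (cyl_len_gt0 F v)).
  by rewrite ge0_ler_powR ?nnegrE ?(ltW t_gt0)// (le_trans (kids_len uv)).
by split; exact: h.
Qed.

Variables (T : choiceType) (B : T -> set R) (a : T -> R) (c : R).
Hypotheses (a_ge0 : forall j, 0 <= a j) (c_gt0 : 0 < c) (c_lt : c < k `^ t).
Hypothesis B_small : forall j x y, B j x -> B j y -> `|x - y| `^ t <= a j.
Hypothesis a_sum : (\esum_(j in [set: T]) (a j)%:E <= c%:E)%E.

Definition meeting u : set T := [set j | B j `&` cyl u !=set0].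

Definition meeting_mass u : \bar R := \esum_(j in meeting u) (a j)%:E.

Definition light u := (meeting_mass u <= (c * l u `^ t)%:E)%E.

Lemma light_le u j : light u -> meeting u j -> a j <= c * l u `^ t.
Proof.
move=> lu uj; rewrite -lee_fin; apply: le_trans lu.
rewrite -(@esum_set1 _ _ j (fun j => (a j)%:E)) ?lee_fin//.
by apply: (@esum_le_inj _ _ _ _ _ id) => // [i ->//|i _]; rewrite lee_fin.
Qed.

(** Averaging: if no child were light, the masses of the children would add up to at least
    [3 * c * l v]^ t[. Yet each]B j[is counted at most twice, and only if it meets the parent, so
    they add up to at most]2 * c * l v [^ t]. *)
Lemma light_kid v : light v -> exists2 u, u \in kids v & light u.
Proof.
move=> lv; apply: contrapT => nolight.
have lv0 : 0 < l v `^ t by apply/powR_gt0/cyl_len_gt0.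
have heavy u : u \in kids v -> ((c * l u `^ t)%:E <= meeting_mass u)%E.
  move=> uv; rewrite leNgt; apply/negP => /ltW lu; apply: nolight.
  by exists u.
have sum_le : (\sum_(u <- kids v) meeting_mass u <= 2%:E * meeting_mass v)%E.
  rewrite (eq_bigr (fun u => \esum_(j in [set: T])
      (if j \in meeting u then (a j)%:E else 0)%E)); last first.
    by move=> u _; rewrite /meeting_mass esum_mkcond.
  rewrite -esum_sum; last by move=> j u _ _; case: ifP; rewrite // lee_fin.
  rewrite /meeting_mass [in leRHS]esum_mkcond.
  apply: esum_le_scale => // j; first by case: ifP; rewrite // lee_fin.
  move=> _; have [jv|njv] := boolP (j \in meeting v); last first.
    rewrite mule0 big_seq big1// => u /kids_extend[w uE].
    case: ifPn => // /set_mem ju; exfalso; move/negP: njv; apply.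
    apply/mem_set; case: ju => x [Bx ux]; exists x; split=> //.
    by move: ux; rewrite uE; exact: cyl_cat.
  rewrite -big_mkcond/= sumEFin -EFinM lee_fin big_const_seq iter_addr_0.
  rewrite -[leLHS]mulr_natl ler_wpM2r// ler_nat.
  rewrite (eq_count (a2 := fun u => `[< B j `&` cyl u !=set0 >])); last first.
    by move=> u; apply/idP/asboolP => [/set_mem|/mem_set].
  apply: (few_kids_meet (B_small (j := j))).
  apply: (le_lt_trans (light_le lv (set_mem jv))).
  rewrite powRM ?(ltW k_gt0) ?(ltW (cyl_len_gt0 F v))//.
  by rewrite ltr_pM2r.
have : (\sum_(u <- kids v) (c * l u `^ t)%:E <= 2%:E * meeting_mass v)%E.
  by apply: le_trans sum_le; rewrite big_seq [leRHS]big_seq; apply: lee_sum.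
apply/negP; rewrite -ltNge.
apply: (@le_lt_trans _ _ (2%:E * (c * l v `^ t)%:E)%E).
  by rewrite lee_wpmul2l.
rewrite sumEFin -EFinM lte_fin -mulr_sumr.
apply: (@lt_le_trans _ _ (c * (3 * l v `^ t))).
  have : 0 < c * l v `^ t by rewrite mulr_gt0.
  lra.
by rewrite ler_wpM2l// ltW.
Qed.

Lemma light_branch : exists v : nat -> seq 'I_m, [/\ v 0%N = [::],
  forall n, v n.+1 \in kids (v n) &
  forall n j x, B j x -> cyl (v n) x -> a j <= c * l (v n) `^ t].
Proof.
have /choice[next hnext] : forall v, exists u, light v -> u \in kids v /\ light u.
  move=> v; have [/light_kid[u uv lu]|nl] := pselect (light v); first by exists u.
  by exists v.
pose v n := iter n next [::].
have lightv n : light (v n).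
  elim: n => [|n IH] /=; last exact: (hnext _ IH).2.
  (* The root has length 1, so its lightness is the bound [c] on the total mass. *)
  rewrite /light /cyl_len/= subr0 normr1 powR1 mulr1; apply: le_trans a_sum.
  by apply: (@esum_le_inj _ _ _ _ _ id) => // j _; rewrite lee_fin.
exists v; split=> // [n|n j x Bx vx]; first exact: (hnext _ (lightv n)).1.
by apply: light_le (lightv n) _; exists x.
Qed.

End Descent.

(** * The tree of steered blocks *)

Section SteeringTree.
Context {R : realType} {m : nat} (F : expanding_interval_map R m).
Implicit Types (g : 'I_m -> R) (u v w : seq 'I_m).

Local Notation l := (cyl_len F).
Local Notation S g u := (\sum_(i <- u) g i).

Lemma seq_cyl_len_lower (X : seq (seq 'I_m)) :
  exists2 k : R, 0 < k & forall u, u \in X -> k <= l u.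
Proof.
elim: X => [|u X [k k0 hk]]; first by exists 1.
exists (Num.min (l u) k); first by rewrite lt_min cyl_len_gt0.
move=> v; rewrite inE ge_min => /orP[/eqP ->|/hk ->]; first by rewrite lexx.
by rewrite orbT.
Qed.

Definition correct g (c_up c_down : seq 'I_m) v := if 0 <= S g v then c_down else c_up.

Definition steering_kids g c_up c_down (E : seq (seq 'I_m)) v :=
  [seq v ++ (correct g c_up c_down v ++ u) | u <- E].

Lemma steering_treeP g t : 0 < t -> steerable l g t ->
  exists (kids : seq 'I_m -> seq (seq 'I_m)) (k b : R),
  [/\ 0 < k,
      forall v, uniq (kids v),
      forall v u, u \in kids v -> exists2 w, w != [::] & u = v ++ w,
      forall v u u', u \in kids v -> u' \in kids v -> size u = size u' &
      forall v u, u \in kids v -> k * l v <= l u] /\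
  (forall v, 3 * l v `^ t <= \sum_(u <- kids v) l u `^ t) /\
  forall v : nat -> seq 'I_m, v 0%N = [::] ->
    (forall n, v n.+1 \in kids (v n)) -> forall n j, `|S g (take j (v n))| <= b.
Proof.
move=> t0 [K [cu [cd [hu hd hE]]]].
have [A A1 hA] := cyl_len_cat F.
have A0 : 0 < A by apply: lt_le_trans A1.
have l0 u : 0 <= l u := ltW (cyl_len_gt0 F u).
have cat_ge u v : A^-1 * (l u * l v) <= l (u ++ v) by have /andP[] := hA u v.
have [lc lc0 hlc] := seq_cyl_len_lower [:: cu; cd].
have corr_in v : correct g cu cd v \in [:: cu; cd].
  by rewrite /correct; case: ifP; rewrite !inE eqxx ?orbT.
(* The factor lost when a corrected block is appended: two concatenations and a correcting word of
   length at least [lc]. *)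
pose q := (A^-1 * (A^-1 * lc)) `^ t.
have q_gt0 : 0 < q by rewrite powR_gt0 ?mulr_gt0 ?invr_gt0.
(* The term [3 / q] compensates for [q] and leaves the factor 3. The 2 excludes block length 0,
   where only the empty word, of mass 1, is available. *)
have [E [n [uE hEu ME]]] := hE (2 + 3 / q).
have n0 : n != 0%N.
  apply/eqP => n0; have : \sum_(u <- E) l u `^ t <= \sum_(u <- [:: [::]]) l u `^ t.
    apply: ler_sum_uniq => // [u|u /hEu[]]; first exact: powR_ge0.
    by rewrite n0 => /size0nil ->; rewrite inE.
  rewrite big_seq1 /cyl_len/= subr0 normr1 powR1 => E1.
  have := le_trans ME E1; have : 0 <= 3 / q by rewrite divr_ge0// ltW.
  lra.
pose kids := steering_kids g cu cd E.
have [k k0 hk] := seq_cyl_len_lower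
  ([seq cu ++ u | u <- E] ++ [seq cd ++ u | u <- E]).
pose G := \sum_i `|g i|.
have G0 : 0 <= G by exact: sumr_ge0.
have SG u : `|S g u| <= (size u)%:R * G.
  elim: u => [|i u IH]; first by rewrite big_nil normr0 mul0r.
  rewrite big_cons /= -add1n natrD mulrDl mul1r.
  apply: (le_trans (ler_normD _ _)); rewrite lerD//.
  by rewrite /G (bigD1 i)//= lerDl sumr_ge0.
pose L := (size cu + size cd + n)%N.
(* [b0] bounds the letter sum at the nodes. Between nodes at most [L] letters are added, each of
   modulus at most [G]. *)
pose b0 := `|S g cu| + `|S g cd| + `|K|.
exists kids, (A^-1 * k), (b0 + L%:R * G); split; [split|split].
- by rewrite mulr_gt0 ?invr_gt0.
- move=> v; rewrite map_inj_in_uniq// => u u' _ _ /eqP.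
  by rewrite !catA eqseq_cat// eqxx /= => /eqP.
- move=> v _ /mapP[u uE' ->]; exists (correct g cu cd v ++ u) => //.
  apply: contra_neq n0 => e; have [<- _] := hEu _ uE'.
  by move/(congr1 size): e; rewrite size_cat => /eqP; rewrite addn_eq0 => /andP[_ /eqP].
- move=> v _ _ /mapP[u uE' ->] /mapP[u' uE'' ->].
  by rewrite !size_cat (hEu _ uE').1 (hEu _ uE'').1.
- move=> v _ /mapP[u uE' ->]; apply: le_trans (cat_ge _ _).
  rewrite -mulrA ler_wpM2l ?invr_ge0 ?(ltW A0)// mulrC ler_wpM2l// hk//.
  rewrite mem_cat /correct; case: ifP => _; apply/orP; [right|left];
    exact: map_f.
- move=> v; rewrite big_map.
  apply: (@le_trans _ _ (\sum_(u <- E) q * l v `^ t * l u `^ t)); last first.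
    apply: ler_sum => u _; set c := correct _ _ _ _.
    have lcc : lc <= l c by apply: hlc; exact: corr_in.
    rewrite /q -!powRM ?mulr_ge0 ?invr_ge0 ?(ltW A0) ?(ltW lc0)//.
    rewrite ge0_ler_powR ?nnegrE ?mulr_ge0 ?invr_ge0 ?(ltW A0) ?(ltW lc0) ?(ltW t0)//.
    apply: le_trans (cat_ge _ _); rewrite -!mulrA ler_wpM2l ?invr_ge0 ?(ltW A0)//.
    rewrite [leLHS](_ : _ = l v * (A^-1 * (lc * l u))); last by ring.
    rewrite ler_wpM2l//; apply: le_trans (cat_ge _ _).
    by rewrite ler_wpM2l ?invr_ge0 ?(ltW A0)// ler_wpM2r.
  rewrite -mulr_sumr mulrAC ler_wpM2r ?powR_ge0//.
  apply: (@le_trans _ _ (q * (2 + 3 / q))); last by rewrite ler_wpM2l// ltW.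
  by rewrite mulrDr mulrCA divff ?gt_eqF// mulr1 lerDr mulr_ge0// ltW.
move=> v v0 vS n'.
suff [] : `|S g (v n')| <= b0 /\ forall j, `|S g (take j (v n'))| <= b0 + L%:R * G by [].
have LG0 : 0 <= L%:R * G by rewrite mulr_ge0.
elim: n' => [|n' [IH1 IH2]].
  rewrite v0 big_nil normr0; split=> [|j]; last by rewrite !addr_ge0.
  by rewrite !addr_ge0.
have /mapP[u uE' ->] := vS n'; have [su Su] := hEu _ uE'.
set c := correct g cu cd (v n').
have Scu : `|S g (v n' ++ (c ++ u))| <= b0.
  rewrite !big_cat/=; move: IH1 Su hu hd; rewrite /c /correct /b0.
  have := ler_norm (S g cu); have := ler_norm (- S g cd); rewrite normrN.
  have := normr_ge0 (S g cu); have := normr_ge0 (S g cd); have := ler_norm K.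
  by case: ifPn; rewrite -?ltNge ?ler_norml; lra.
split=> // j; rewrite take_cat; case: ifP => _; first exact: IH2.
rewrite big_cat/=; apply: (le_trans (ler_normD _ _)); rewrite lerD//.
apply: (le_trans (SG _)); rewrite ler_wpM2r// ler_nat.
apply: leq_trans (_ : size (c ++ u) <= _)%N; first by rewrite size_take_min geq_minr.
rewrite size_cat su leq_add2r.
by rewrite /c /correct; case: ifP => _; rewrite ?leq_addr ?leq_addl.
Qed.

(** Each extension adds a letter, so [v j.+1] is longer than [j] and its letter at [j] is final. *)
Lemma word_limit (i0 : 'I_m) (v : nat -> seq 'I_m) : v 0%N = [::] ->
  (forall n, exists2 w, w != [::] & v n.+1 = v n ++ w) ->
  exists w : nat -> 'I_m, forall n, prefix_word w (size (v n)) = v n.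
Proof.
move=> v0 vS.
have sv n : (n <= size (v n))%N.
  elim: n => // n IH; have [w w0 ->] := vS n.
  by rewrite size_cat -addn1 leq_add// lt0n size_eq0.
have vD n d : exists w, v (n + d)%N = v n ++ w.
  elim: d => [|d [w IH]]; first by exists [::]; rewrite addn0 cats0.
  by have [w' _ e] := vS (n + d)%N; exists (w ++ w'); rewrite addnS e IH catA.
have nthv n n' j : (j < size (v n))%N -> (n <= n')%N ->
    nth i0 (v n') j = nth i0 (v n) j.
  move=> jn nn'; have [w e] := vD n (n' - n)%N.
  by move: e; rewrite subnKC// => ->; rewrite nth_cat jn.
exists (fun j => nth i0 (v j.+1) j) => n.
apply: (@eq_from_nth _ i0); rewrite size_prefix_word// => j jn.
rewrite nth_mkseq//.
have jj : (j < size (v j.+1))%N by exact: sv.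
by rewrite -(nthv _ _ _ jj (leq_maxl _ n)) (nthv _ _ _ jn (leq_maxr j.+1 _)).
Qed.

End SteeringTree.

(** * The dimension of the escaping sets *)

Section Dimension.
Context {R : realType} {m : nat} (F : expanding_interval_map R m).
Variables (Psi : R -> int) (alpha : R).
Hypothesis hPsi : constant_on_branches F Psi.
Variable i0 : 'I_m.
Implicit Types (w : nat -> 'I_m) (u : seq 'I_m) (X : set R).

Local Notation hw u := (inv_branch_word F u).
Local Notation l := (cyl_len F).
Local Notation lift := Defs.lift.
Local Notation shift := Defs.shift.

Definition drift (i : 'I_m) : R := (step_length F Psi (fun=> i))%:~R - alpha.

Lemma bounded_wordsE K : bounded_words F Psi alpha K = balanced_words drift K.
Proof.
rewrite /bounded_words /balanced_words.
have e u : word_sum (fun w => (step_length F Psi w)%:~R - alpha) u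
    = \sum_(i <- u) drift i by exact: (word_sum_letter i0 drift).
by apply/seteqP; split=> u /=; rewrite e.
Qed.

Lemma iter_lift_drift w (k : int) n : ~ endpoints F (coding F w) ->
  iter n (lift F Psi) (coding F w + k%:~R) - n%:R * alpha
    = coding F (iter n shift w) + k%:~R + \sum_(i <- prefix_word w n) drift i.
Proof.
move=> nw; rewrite (iter_lift_coding hPsi)// intrD -!addrA; congr (_ + (_ + _)).
rewrite /prefix_word big_map -[in RHS](subn0 n) [RHS]big_mkord.
by rewrite big_split/= sumrN sumr_const card_ord mulr_natl raddf_sum.
Qed.

Lemma infinite_set_unbounded (A : set nat) n : infinite_set A ->
  exists2 k, A k & (n <= k)%N.
Proof.
move=> Ainf; apply: contrapT => nA; apply: Ainf.
apply: (sub_finite_set _ (finite_II n)) => k Ak /=.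
by rewrite ltnNge; apply/negP => nk; apply: nA; exists k.
Qed.

Lemma escaping_coding x : escaping F Psi alpha x -> exists w (k : int) (N : nat),
  x = coding F w + k%:~R /\
  forall n, exists2 n', balanced_words drift N%:R (prefix_word w n') & (n <= n')%N.
Proof.
move=> [[y [[w _ <-] nw] [k _ <-]] [K K0 Kinf]].
(* The terms account for the displacement, the integer translation and the fractional part. A
   natural bound keeps the parameters [(k, N)] countable. *)
exists w, k, (Num.trunc (K + `|k%:~R| + 1)).+1; split=> // n.
have [n' /= hn' nn'] := infinite_set_unbounded n Kinf; exists n' => //.
rewrite /balanced_words/=; apply: le_trans (ltW (truncnS_gt _)).
move: hn'; rewrite iter_lift_drift//.
have /andP[] := coding_itv F (iter n' shift w).
have := ler_norm (k%:~R : R); have := ler_norm (- k%:~R : R); rewrite normrN.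
by rewrite !ler_norml; lra.
Qed.

Lemma uniformly_escaping_coding w b : ~ endpoints F (coding F w) ->
  (forall n, `|\sum_(i <- prefix_word w n) drift i| <= b) ->
  uniformly_escaping F Psi alpha (coding F w).
Proof.
move=> nw hb; split.
  by exists (coding F w); [split=> //; exists w|exists 0 => //; rewrite addr0].
have b0 : 0 <= b := le_trans (normr_ge0 _) (hb 0%N).
exists (b + 1) => [|n]; first by rewrite ltr_wpDl.
have e := iter_lift_drift 0 n nw; rewrite mulr0z !addr0 in e; rewrite e.
have /andP[] := coding_itv F (iter n shift w); have := hb n.
by rewrite !ler_norml; lra.
Qed.

Lemma uniformly_escaping_sub :
  uniformly_escaping F Psi alpha `<=` escaping F Psi alpha.
Proof.
move=> x [Lx [K K0 hK]]; split=> //; exists K => //.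
rewrite (_ : [set _ | _] = [set: nat]); first exact: infinite_nat.
by apply/seteqP; split=> n // _; exact: hK.
Qed.

(** The sets covering [X] are the integer translates of cylinders, indexed by the translation and
    the bound on the letter sum. *)
Lemma escaping_null X s : X `<=` escaping F Psi alpha -> 0 <= s ->
  (forall K, (word_series l s (balanced_words drift K) < +oo)%E) ->
  hausdorff_measure s X = 0%E.
Proof.
move=> XE s0 hK.
have [r r01 hr] := cyl_len_exp F.
pose W (p : int * nat) := balanced_words drift p.2%:R.
pose J (p : int * nat) u := [set x + p.1%:~R | x in cyl F u].
apply: (limsup_null r01 hr (W := W) (J := J) s0).
- by move=> p; exact: hK.
- move=> p u _ _ [x /cylP[p1 i1 <-] <-] [y /cylP[p2 i2 <-] <-].
  by rewrite opprD addrACA subrr addr0; exact: cyl_diam.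
move=> x /XE/escaping_coding[w [k [N [-> hn]]]]; exists (k, N) => n.
have [n' bn nn'] := hn n; exists (prefix_word w n').
rewrite size_prefix_word; split=> //; exists (coding F w) => //.
by apply/cylP; exact: codingP.
Qed.

Lemma powR_anti_exp (x s t : R) : 0 <= x <= 1 -> s <= t -> 0 < t ->
  x `^ t <= x `^ s.
Proof.
move=> /andP[]; rewrite le_eqVlt => /orP[/eqP <- _ _ t0|x0 x1 st _].
  by rewrite powR0 ?powR_ge0// gt_eqF.
by apply: ger_powR; rewrite ?x0.
Qed.

(** A null set would have covers of arbitrarily small weight; the descent in the steering tree finds
    a uniformly escaping point outside such a cover. *)
Lemma escaping_not_null X s t : uniformly_escaping F Psi alpha `<=` X ->
  s <= t -> 0 <= s -> 0 < t -> steerable l drift t ->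
  hausdorff_measure s X <> 0%E.
Proof.
move=> EX st s0 t0 hsteer HX.
have [kids [k [b [[k0 ku ke ks kl] [k3 kb]]]]] := steering_treeP t0 hsteer.
have [r r01 hr] := cyl_len_exp F.
pose c := k `^ t / 2.
have kt0 : 0 < k `^ t by exact: powR_gt0.
have c0 : 0 < c by rewrite divr_gt0.
have ck : c < k `^ t by rewrite /c; lra.
(* The budget [c] is shared by the cover, the padding of its weights, and the endpoints. *)
pose e := c / 3.
have e0 : 0 < e by rewrite divr_gt0.
have [_ [U [XU Ud] <-] Ue] : exists2 x, [set (\sum_(0 <= n <oo) diam_weight s (U n))%E |
    U in [set U : (set R)^nat | X `<=` \bigcup_n U n /\
      forall n, (diam (U n) <= 1%:E)%E]] x & (x < e%:E)%E.
  apply: ereal_inf_lt; apply: le_lt_trans (_ : 0%:E < e%:E)%E; last by rewrite lte_fin.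
  have : (hausdorff_premeasure s 1 X <= hausdorff_measure s X)%E.
    by apply: ereal_sup_ubound; exists 1 => //; exact: ltr01.
  by rewrite HX.
pose wt n := diam_weight s (U n).
have wt0 n : (0 <= wt n)%E by exact: diam_weight_ge0.
have wt_fin n : wt n \is a fin_num.
  rewrite ge0_fin_numE//; apply: le_lt_trans (ltry e); apply: le_trans (ltW Ue).
  rewrite nneseries_esumT//; apply: esum_ge; exists [set n].
    by split=> //; exact: finite_set1.
  by rewrite fsbig_set1.
have half0 n : 0 < e / (2 ^ n.+1)%:R by rewrite divr_gt0// ltr0n expn_gt0.
(* The countably many endpoints are avoided along with the [U n], so that the
   limit point lies in the lift space. The extra [e / 2 ^ n.+1] makes [a]
   positive even where [U n] has diameter 0. *)
pose T := (nat + (seq 'I_m * bool))%type.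
pose B (j : T) := match j with
  | inl n => U n | inr p => [set hw p.1 (p.2%:R : R)] end.
pose a (j : T) := match j with
  | inl n => fine (wt n) + e / (2 ^ n.+1)%:R
  | inr p => e / (2 ^ (pickle p).+1)%:R end.
have a0 j : 0 < a j by case: j => [n|p]; rewrite /a ?ltr_wpDl ?fine_ge0.
have a_sum : (\esum_(j in [set: T]) (a j)%:E <= c%:E)%E.
  pose V (h : bool) : set T := if h then range inl else range inr.
  have a0' j : (0 <= (a j)%:E)%E by rewrite lee_fin ltW.
  apply: (le_trans (esum_le_cover (V := V) a0' _)).
    by move=> [n|p] _; [exists true, n|exists false, p].
  rewrite big_bool/= !esum_image//; [|by move=> ? ? _ _ []|by move=> ? ? _ _ []].
  have -> : c = e + e + e by rewrite /e; field.
  rewrite EFinD; apply: leeD.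
    rewrite -nneseries_esumT; last by move=> n; exact: (a0' (inl n)).
    rewrite (eq_eseriesr (g := fun n => (wt n + (e / (2 ^ n.+1)%:R)%:E)%E)); last first.
      by move=> n _; rewrite /a EFinD fineK.
    apply: (le_trans (epsilon_trick _ _ _)) => //; first exact: ltW.
    by rewrite EFinD leeD2r// ltW.
  apply: le_trans (epsilon_trick0 xpredT (ltW e0)).
  rewrite nneseries_esumT; last by move=> n; rewrite lee_fin ltW.
  by apply: (@esum_le_inj _ _ _ _ _ pickle) => // n _; rewrite lee_fin ltW.
have B_small j x y : B j x -> B j y -> `|x - y| `^ t <= a j.
  case: j => [n|p] /=; last first.
    by move=> -> ->; rewrite subrr normr0 powR0 ?gt_eqF// ltW.
  move=> Ux Uy.
  (* Diameters at most 1 allow passing from exponent [s] to the larger exponent [t]. *)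
  have xy1 : `|x - y| <= 1.
    by rewrite -lee_fin; apply: le_trans (Ud n); exact: dist_le_diam.
  apply: (@le_trans _ _ (`|x - y| `^ s)).
    by apply: powR_anti_exp; rewrite ?normr_ge0.
  apply: (@le_trans _ _ (fine (wt n))); last by rewrite lerDl ltW.
  by rewrite -lee_fin fineK//; exact: dist_powR_le_weight.
have ke' v u : u \in kids v -> exists z, u = v ++ z by move=> /ke[w _]; exists w.
have [v [v0 vS vB]] := light_branch t0 k0 ku ke' ks kl k3
  (fun j => ltW (a0 j)) c0 ck B_small a_sum.
have [w hwv] := word_limit i0 v0 (fun n => ke _ _ (vS n)).
pose x := coding F w.
have xv n : cyl F (v n) x.
  by apply/cylP; rewrite -(hwv n); exact: codingP.
have sv n : (n <= size (v n))%N.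
  elim: n => // n IH; have [z z0 ->] := ke _ _ (vS n).
  by rewrite size_cat -addn1 leq_add// lt0n size_eq0.
have /andP[r0 r1] := r01.
have avoid j : ~ B j x.
  move=> Bx; have rt : 0 < r `^ t < 1.
    rewrite powR_gt0//=; have -> : 1 = 1 `^ t :> R by rewrite powR1.
    by rewrite gt0_ltr_powR ?nnegrE// ltW.
  have [n hn] := exprn_small rt (divr_gt0 (a0 j) c0).
  have := vB n j x Bx (xv n); apply/negP; rewrite -ltNge mulrC -ltr_pdivlMr//.
  apply: le_lt_trans hn; rewrite -powR_mulrn ?powR_ge0// -powRrM mulrC powRrM.
  rewrite powR_mulrn ?(ltW r0)// ge0_ler_powR ?nnegrE ?exprn_ge0 ?(ltW r0) ?(ltW t0)//.
    exact/ltW/cyl_len_gt0.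
  apply: (le_trans (hr _)); rewrite ler_wiXn2l ?(ltW r0) ?(ltW r1)//.
have nx : ~ endpoints F x.
  move=> [u _ [p p01 hp]]; case: p01 => pE.
    by apply: (avoid (inr (u, false))); rewrite /B/= -hp pE.
  by apply: (avoid (inr (u, true))); rewrite /B/= -hp pE.
have /EX/XU[n _] : uniformly_escaping F Psi alpha x.
  apply: (uniformly_escaping_coding (b := b)) => // n.
  have -> : prefix_word w n = take n (v n).
    rewrite -{1}(hwv n) -(subnKC (sv n)) prefix_wordD take_size_cat//.
    by rewrite size_prefix_word.
  exact: kb.
exact: (avoid (inl n)).
Qed.

Lemma poincare_series_fin s K : 0 <= s ->
  (\esum_(u in bounded_words F Psi alpha K)
     (expR (s * word_sum (geometric_potential F) u))%:E < +oo)%E <->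
  (word_series l s (balanced_words drift K) < +oo)%E.
Proof.
move=> s0; rewrite bounded_wordsE; have [A A1 hA] := word_sum_geometric F i0.
have A0 : 0 < A by apply: lt_le_trans A1.
have As0 : 0 <= A `^ s := powR_ge0 _ _.
have E u : expR (s * word_sum (geometric_potential F) u)
    = expR (word_sum (geometric_potential F) u) `^ s.
  by rewrite /powR gt_eqF ?expR_gt0// expRK.
have l0 u : 0 <= l u := ltW (cyl_len_gt0 F u).
split=> fin.
  apply: (@le_lt_trans _ _ ((A `^ s)%:E * _)%E); last first.
    by apply: lte_mul_pinfty fin; rewrite ?lee_fin.
  apply: esum_le_scale => // u.
  move=> _; rewrite -EFinM lee_fin E -powRM ?expR_ge0 ?(ltW A0)//.
  rewrite ge0_ler_powR ?nnegrE ?mulr_ge0 ?expR_ge0 ?(ltW A0)//.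
  by have /andP[] := hA u; rewrite ler_pdivrMl.
apply: (@le_lt_trans _ _ ((A `^ s)%:E * _)%E); last first.
  by apply: lte_mul_pinfty fin; rewrite ?lee_fin.
apply: esum_le_scale => // u; first by rewrite lee_fin powR_ge0.
move=> _; rewrite -EFinM lee_fin E -powRM ?(ltW A0)//.
rewrite ge0_ler_powR ?nnegrE ?mulr_ge0 ?expR_ge0 ?(ltW A0)//.
by have /andP[] := hA u.
Qed.

(** Stated for any set between the two escaping sets, so that it covers both. Exponents with finite
    series give null sets; conversely, if [X] is null at [s], the series is finite at every
    [s + e]. *)
Lemma hausdorff_dim_escaping X : uniformly_escaping F Psi alpha `<=` X ->
  X `<=` escaping F Psi alpha -> forall K,
  (forall s K', 0 <= s -> (word_series l s (balanced_words drift K) < +oo)%E ->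
     (word_series l s (balanced_words drift K') < +oo)%E) ->
  (forall s t, 0 <= t -> t < s ->
     word_series l s (balanced_words drift K) = +oo%E -> steerable l drift t) ->
  hausdorff_dim X = poincare_exponent F Psi alpha K.
Proof.
move=> EX XE K hfin hoo; apply/eqP; rewrite eq_le; apply/andP; split.
  apply: le_ereal_inf_tmp => _ [s [s0 /(poincare_series_fin _ s0) sfin] <-].
  apply: ereal_inf_lbound; exists s => //; split=> //.
  by apply: escaping_null => // K'; exact: hfin.
apply: le_ereal_inf_tmp => _ [s [s0 HX] <-].
apply/lee_addgt0Pr => e e0; rewrite -EFinD.
have [fin|] := ltP (word_series l (s + e) (balanced_words drift K)) +oo%E.
  apply: ereal_inf_lbound; exists (s + e) => //; split.
    by rewrite addr_ge0 ?(ltW e0).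
  by apply/poincare_series_fin => //; rewrite addr_ge0 ?(ltW e0).
rewrite leye_eq => /eqP oo; exfalso.
(* This exponent lies strictly between [s] and [s + e] and is positive even when [s] is 0. *)
have t0 : 0 < s + e / 2 by lra.
apply: (escaping_not_null EX _ s0 t0 _ HX); first by lra.
by apply: (hoo (s + e)) => //; [exact: ltW|lra].
Qed.

End Dimension.

Theorem theorem1p5 (R : realType) (m : nat) (hm : (2 <= m)%N)
    (F : expanding_interval_map R m) (Psi : R -> int)
    (hPsi : constant_on_branches F Psi) (alpha : R) :
  exists2 K0 : R, 0 < K0 &
    forall K : R, K0 <= K ->
      hausdorff_dim (escaping F Psi alpha) = poincare_exponent F Psi alpha K /\
      hausdorff_dim (uniformly_escaping F Psi alpha)
        = poincare_exponent F Psi alpha K.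
Proof.
pose i0 : 'I_m := Ordinal (ltnW hm).
have [A A1 hA] := cyl_len_cat F.
have [r r01 hr] := cyl_len_exp F.
have [K0 K00 hK0] := balanced_words_dichotomy (cyl_len_gt0 F) A1 hA r01 hr
  (drift F Psi alpha).
exists K0 => // K /hK0[hfin hoo].
have EuE := @uniformly_escaping_sub R m F Psi alpha.
by split; apply: (hausdorff_dim_escaping hPsi i0 _ _ hfin hoo).
Qed.
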